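(* Let $\{1,\varphi_k: k\ge1\}$ be an orthonormal system (basis) in $L^2(0,1)$ and $(\lambda_k)_{k\ge1}$ real numbers with $\sum_k\lambda_k^2<\infty$ and $$1+\sum_{k=1}^\infty\lambda_k\varphi_k(x)\varphi_k(y)\ge0\quad\text{for all }(x,y)\in[0,1]^2,$$ and let $C$ be the copula $$C(u,v)=uv+\sum_{k=1}^\infty\lambda_k\int_0^u\varphi_k(x)\,dx\int_0^v\varphi_k(y)\,dy.$$ Then for every $n\ge1$ $$C^n(u,v)=uv+\sum_{k=1}^\infty\lambda_k^n\int_0^u\varphi_k(x)\,dx\int_0^v\varphi_k(y)\,dy.$$ Moreover, for the stationary Markov chain generated by $C$ with uniform marginals, $\rho_n=\sup_k|\lambda_k|^n$, and the chain is both geometrically ergodic and exponential $\rho$-mixing if and only if $\sup_k|\lambda_k|<1$. If the sum defining $C$ has a finite number of non-zero terms with $|\lambda_k|<1$ for all $k$, then the Markov chain generated with uniform marginals is $\psi$-mixing.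
   Context: A (bivariate) copula is the restriction to $[0,1]^2$ of a bivariate cumulative distribution function with uniform marginals. The powers are $C^1=C$ and $C^n(u,v)=\int_0^1 C^{n-1}_{,2}(u,t)C_{,1}(t,v)\,dt$ for $n>1$, where $C_{,i}$ is the partial derivative in the $i$-th variable. The stationary Markov chain $(U_n)_{n\ge0}$ generated by $C$ with uniform marginals has $U_n$ uniform on $(0,1)$ and $(U_n,U_{n+1})$ with joint distribution function $C$. The mixing coefficients are $$\rho_n=\sup_f\{|\mathbb{E}(f(U_0)f(U_n))|:\ \mathbb{E}f(U_0)=0,\ \mathbb{E}f^2(U_0)=1\},$$ $$\psi_n=\sup_{P(A)P(B)>0}\frac{|P^n(A\cap B)-P(A)P(B)|}{P(A)P(B)},$$ with $A,B$ Borel, $P(A)=P(U_0\in A)$, $P^n(A\cap B)=P(U_0\in A,U_n\in B)$. The chain is exponential $\rho$-mixing if $\rho_n\to0$ exponentially fast, $\psi$-mixing if $\psi_n\to0$. Geometric ergodicity is the usual notion: for almost every starting point the $n$-step transition probabilities converge to the stationary distribution in total variation at an exponential rate. *)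

(* Defs.v *)
From HB Require Import structures.
From mathcomp Require Import all_boot all_order all_algebra.
From mathcomp Require Import all_classical all_reals all_analysis.

Set Implicit Arguments.
Unset Strict Implicit.
Unset Printing Implicit Defensive.

Import Order.TTheory GRing.Theory Num.Theory.
Import numFieldNormedType.Exports.

Local Open Scope classical_set_scope.
Local Open Scope ring_scope.

Section Copulas.
Variable R : realType.
Local Notation leb := (@lebesgue_measure R).
Local Notation I01 := (`[0%R, 1%R]%classic : set R).

Definition unif : probability (measurableTypeR R) R :=
  uniform_prob (@ltr01 R).

(* Only the values of [C] on [0,1]^2 matter: a copula is represented by any
   total function extending it. *)
Definition is_copula (C : R -> R -> R) : Prop :=
  exists mu : probability (measurableTypeR R * measurableTypeR R)%type R,
    [/\ forall A, measurable A -> mu (A `*` [set: R]) = unif A,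
        forall A, measurable A -> mu ([set: R] `*` A) = unif A &
        forall u v, u \in `[0, 1] -> v \in `[0, 1] ->
          mu (`]-oo, u] `*` `]-oo, v]) = (C u v)%:E].

(* The partial derivatives of a copula exist almost everywhere in each
   variable; the values of the total operator [derive1] elsewhere do not
   affect the integral. *)
Definition copula_prod (A B : R -> R -> R) : R -> R -> R := fun u v =>
  \int[leb]_(t in I01)
    (derive1 (fun s => A u s) t * derive1 (fun s => B s v) t).

(* [copula_pow C n] is C^n for n >= 1 (the value at n = 0 is junk). *)
Definition copula_pow (C : R -> R -> R) (n : nat) : R -> R -> R :=
  iter n.-1 (fun D => copula_prod D C) C.

(* Here and below, [phi k] and [lambda k] for k >= 0 stand for the functions
   and coefficients of index k + 1. *)
Definition with_one (phi : nat -> R -> R) (k : nat) : R -> R :=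
  if k is j.+1 then phi j else cst 1.

Definition orthonormal_system (e : nat -> R -> R) : Prop :=
  (forall k, measurable_fun I01 (e k)) /\
  (forall j k, \int[leb]_(x in I01) (e j x * e k x)%:E = (j == k)%:R%:E)%E.

(* Under square summability of [lambda] the series
   1 + \sum_k lambda_k phi_k(x) phi_k(y) converges in L^2([0,1]^2), but it need
   not converge at every point. Its sum is therefore taken in L^2, and it is
   required to have a version [c] that is nonnegative at every point of the
   square. If the series converges everywhere on the square, this is implied by
   nonnegativity of its pointwise sum, which is then such a version. *)
Definition L2_sum (lambda : nat -> R) (phi : nat -> R -> R)
    (c : R -> R -> R) : Prop :=
  measurable_fun (I01 `*` I01) (fun z => c z.1 z.2) /\
  ((\int[leb \x leb]_(z in I01 `*` I01)
     ((1 + \sum_(k < n) (lambda k * phi k z.1 * phi k z.2)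
       - c z.1 z.2) ^+ 2)%:E) @[n --> \oo] --> 0)%E.

Definition kernel_ge0 (lambda : nat -> R) (phi : nat -> R -> R) : Prop :=
  exists2 c : R -> R -> R, L2_sum lambda phi c &
    forall x y, x \in `[0, 1] -> y \in `[0, 1] -> 0 <= c x y.

(* For bounded [lambda] the series converges absolutely, by Bessel's inequality
   for the indicator functions of [0,u] and [0,v]; the limit is a genuine one. *)
Definition series_copula (lambda : nat -> R) (phi : nat -> R -> R)
    : R -> R -> R := fun u v =>
  u * v + limn (series (fun k =>
    lambda k * (\int[leb]_(x in `[0, u]) phi k x)
             * (\int[leb]_(y in `[0, v]) phi k y))).

End Copulas.

Section MarkovChains.
Context {R : realType} {d : measure_display} {T : measurableType d}.
Variables (P : probability T R) (U : nat -> {RV P >-> R}).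

(* The sigma-algebra generated by U_0, ..., U_n. *)
Definition past (n : nat) : set (set T) :=
  <<s \bigcup_(i in `I_n.+1) preimage_set_system setT (U i) measurable >>.

(* [kappa] is the transition kernel of the chain; the last condition says that
   kappa(U_n, B) is a version of P(U_{n+1} \in B | U_0, ..., U_n). *)
Definition stationary_chain (C : R -> R -> R) (kappa : R.-pker R ~> R) : Prop :=
  [/\ forall n A, measurable A -> P (U n @^-1` A) = unif R A,
      forall n u v, u \in `[0, 1] -> v \in `[0, 1] ->
        P [set w | U n w <= u /\ U n.+1 w <= v] = (C u v)%:E &
      forall n B E, measurable B -> past n E ->
        P (E `&` U n.+1 @^-1` B) = (\int[P]_(w in E) kappa (U n w) B)%E].

Definition rho (n : nat) : \bar R :=
  ereal_sup [set r | exists f : R -> R,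
    [/\ measurable_fun setT f,
        (\int[P]_w (f (U 0 w))%:E = 0)%E,
        (\int[P]_w (f (U 0 w) ^+ 2)%:E = 1)%E &
        r = `| \int[P]_w (f (U 0 w) * f (U n w))%:E |%E ]].

Definition exp_rho_mixing : Prop :=
  exists r M : R, [/\ 0 <= r, r < 1 &
    forall n, (1 <= n)%N -> (rho n <= (M * r ^+ n)%:E)%E].

Definition psi (n : nat) : \bar R :=
  ereal_sup [set r | exists A B : set R,
    [/\ measurable A, measurable B,
        (0 < P (U 0 @^-1` A) * P (U 0 @^-1` B))%E &
        r = (`| P (U 0 @^-1` A `&` U n @^-1` B)
                - P (U 0 @^-1` A) * P (U 0 @^-1` B) |
             / (P (U 0 @^-1` A) * P (U 0 @^-1` B)))%E ]].

Definition psi_mixing : Prop := (psi n @[n --> \oo] --> 0)%E.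

End MarkovChains.

Section Ergodicity.
Context {R : realType}.

Fixpoint nstep (kappa : R.-pker R ~> R) (n : nat) (x : R) (A : set R) : \bar R :=
  if n is m.+1 then (\int[kappa x]_y nstep kappa m y A)%E else \d_x A.

Definition tv_dist (mu nu : set R -> \bar R) : \bar R :=
  ereal_sup [set `| mu A - nu A |%E | A in measurable].

Definition geometrically_ergodic (kappa : R.-pker R ~> R)
    (pi : probability (measurableTypeR R) R) : Prop :=
  exists r : R, [/\ 0 <= r, r < 1 &
    {ae pi, forall x, exists M : R,
       forall n, (tv_dist (nstep kappa n x) pi <= (M * r ^+ n)%:E)%E}].

End Ergodicity.

(* Main.v *)
(* The kernel c(x,y) = 1 + sum_k lambda_k phi_k(x) phi_k(y) is square integrable
   on the unit square, so T f(x) = int c(x,y) f(y) dy is a symmetric operator with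
     <T f, g> = sum_k lam_k <f, e_k> <g, e_k>,  e_0 = 1, lam_0 = 1,
   for all f, g in L^2. Taking g = e_k gives <T f, e_k> = lam_k <f, e_k>, hence
     <T^n f, g> = sum_k lam_k^n <f, e_k> <g, e_k>;
   neither completeness of the system nor the spectral theorem is needed.
   By Lebesgue differentiation the partial derivatives of C are T applied to
   indicators of intervals, so that C^n(u,v) = <T^n 1_[0,u], 1_[0,v]>. For a.e. x
   the transition probability kappa(x, .) has density c(x, .), hence
   E f(U_0) g(U_n) = <T^n f, g>; Bessel's inequality then yields rho_n and, applied
   to f = c(x, .), geometric ergodicity. For finitely many nonzero lambda_k the
   positivity of T gives |lambda_k <1_A, phi_k>| <= K P(A), which gives
   psi-mixing. *)

Require Import Defs.
From HB Require Import structures.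
From mathcomp Require Import all_boot all_order all_algebra ring lra.
From mathcomp Require Import all_classical all_reals all_analysis measurable_realfun.

Set Implicit Arguments.
Unset Strict Implicit.
Unset Printing Implicit Defensive.

Import Order.TTheory GRing.Theory Num.Theory.
Import numFieldNormedType.Exports.

Local Open Scope classical_set_scope.
Local Open Scope ring_scope.

(** * Square-integrable functions *)

(** Everything lives on the whole line with the uniform law; functions and kernel are extended by
    zero off the unit interval, and the constant 1 becomes the basis element of index 0, with
    coefficient 1. The L2 sum controls the kernel only up to null sets, so T is handled through its
    pairings <T f, g> and identities are proved weakly. The transition kernel [kappa] is not given
    by a formula either: the joint law ties [kappa x B] to c only for almost every x, with a null
    set depending on B. Geometric ergodicity fixes x before taking the supremum over sets, so these
    null sets must be merged; rational rays, a countable family that determines a measure, achieve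
    this. No eigenfunction is assumed to be bounded. Correlations of an unbounded f are therefore
    reached through nonnegative functions, and the coefficient bound behind psi-mixing comes from
    pairing T 1_A with bounded functions almost dual to the phi_k, then solving a linear system
    close to the identity. *)

Section SquareIntegrable.
Context {d} {X : measurableType d} {R : realType}.
Variable mu : {measure set X -> \bar R}.

Definition sqint (f : X -> R) :=
  measurable_fun setT f /\ mu.-integrable setT (EFin \o (fun x => f x ^+ 2)).

Definition ip (f g : X -> R) : R := (\int[mu]_x (f x * g x))%R.

(** Since [|f g| <= f^2 + g^2]. Thus [ip], the [fine] part of an extended integral, is a genuine
    value on square-integrable functions. *)
Lemma sqintM (f g : X -> R) : sqint f -> sqint g ->
  mu.-integrable setT (EFin \o (fun x => f x * g x)).
Proof.
move=> [mf f2] [mg g2]; apply: le_integrable (integrableD _ f2 g2) => //.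
  by apply/measurable_EFinP; exact: measurable_funM.
move=> x _ /=; rewrite lee_fin (ger0_norm (addr_ge0 (sqr_ge0 _) (sqr_ge0 _))).
by rewrite ler_norml; apply/andP; split; nra.
Qed.

Lemma EFin_ip (f g : X -> R) : sqint f -> sqint g ->
  (ip f g)%:E = (\int[mu]_x (f x * g x)%:E)%E.
Proof. by move=> Lf Lg; rewrite fineK// (integrable_fin_num _ (sqintM Lf Lg)). Qed.

Lemma le_sqint (f g : X -> R) : measurable_fun setT f -> sqint g ->
  (forall x, `|f x| <= `|g x|) -> sqint f.
Proof.
move=> mf [mg g2] fg; split => //; apply: le_integrable g2 => //.
  by apply/measurable_EFinP; exact: measurable_funX.
by move=> x _ /=; rewrite lee_fin !normrX lerXn2r ?nnegrE.
Qed.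

Lemma sqintZ (a : R) (f : X -> R) : sqint f -> sqint (fun x => a * f x).
Proof.
move=> [mf f2]; split; first exact: measurable_funM.
apply: eq_integrable (integrableZl measurableT (a ^+ 2) f2) => //.
by move=> x _ /=; rewrite -EFinM exprMn.
Qed.

Lemma sqintD (f g : X -> R) : sqint f -> sqint g -> sqint (fun x => f x + g x).
Proof.
move=> Lf Lg; have [mf f2] := Lf; have [mg g2] := Lg.
split; first exact: measurable_funD.
have i2 := integrableD measurableT f2 g2.
have i3 := integrableZl measurableT 2 (sqintM Lf Lg).
apply: eq_integrable (integrableD measurableT i2 i3) => //.
by move=> x _ /=; rewrite -EFinM -!EFinD; congr EFin; ring.
Qed.

Lemma sqintB (f g : X -> R) : sqint f -> sqint g -> sqint (fun x => f x - g x).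
Proof.
move=> Lf Lg; have := sqintD Lf (sqintZ (-1) Lg).
by under [X in sqint X]eq_fun do rewrite mulN1r.
Qed.

Lemma sqint0 : sqint (cst 0).
Proof.
split => //; apply: eq_integrable (integrable0 mu setT) => //.
by move=> x _ /=; rewrite expr0n.
Qed.

Lemma sqint_sum (I : Type) (s : seq I) (F : I -> X -> R) :
  (forall i, sqint (F i)) -> sqint (fun x => \sum_(i <- s) F i x).
Proof.
move=> LF; elim: s => [|i s IH].
  by under [X in sqint X]eq_fun do rewrite big_nil; exact: sqint0.
by under [X in sqint X]eq_fun do rewrite big_cons; exact: sqintD.
Qed.

Lemma ipC f g : ip f g = ip g f.
Proof. by apply: eq_Rintegral => x _; rewrite mulrC. Qed.

Lemma ipDl f g h : sqint f -> sqint g -> sqint h ->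
  ip (fun x => f x + g x) h = ip f h + ip g h.
Proof.
move=> Lf Lg Lh; rewrite /ip -RintegralD//; [|exact: sqintM..].
by apply: eq_Rintegral => x _; rewrite mulrDl.
Qed.

Lemma ipZl a f g : sqint f -> sqint g -> ip (fun x => a * f x) g = a * ip f g.
Proof.
move=> Lf Lg; rewrite /ip -RintegralZl//; last exact: sqintM.
by apply: eq_Rintegral => x _; rewrite mulrA.
Qed.

Lemma ipBl f g h : sqint f -> sqint g -> sqint h ->
  ip (fun x => f x - g x) h = ip f h - ip g h.
Proof.
move=> Lf Lg Lh; rewrite /ip -RintegralB//; [|exact: sqintM..].
by apply: eq_Rintegral => x _; rewrite mulrBl.
Qed.

Lemma ip0l g : ip (cst 0) g = 0.
Proof.
rewrite /ip; under eq_Rintegral do rewrite /cst mul0r.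
by rewrite /Rintegral integral0.
Qed.

Lemma ip_suml (I : Type) (s : seq I) (F : I -> X -> R) g :
  (forall i, sqint (F i)) -> sqint g ->
  ip (fun x => \sum_(i <- s) F i x) g = \sum_(i <- s) ip (F i) g.
Proof.
move=> LF Lg; elim: s => [|i s IH].
  by under [X in ip X]eq_fun do rewrite big_nil; rewrite big_nil ip0l.
rewrite big_cons -IH -ipDl//; last exact: sqint_sum.
by congr (ip _ g); apply/funext => x; rewrite big_cons.
Qed.

Lemma ip_ge0 f : 0 <= ip f f.
Proof. by apply: Rintegral_ge0 => x _; rewrite -expr2 sqr_ge0. Qed.

Lemma ip_sqrB t f g : sqint f -> sqint g ->
  ip (fun x => f x - t * g x) (fun x => f x - t * g x) =
  ip f f - 2 * t * ip f g + t ^+ 2 * ip g g.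
Proof.
move=> Lf Lg; have Lt := sqintZ t Lg; have Lb := sqintB Lf Lt.
rewrite ipBl// ipZl// !(ipC _ (fun x => f x - _)) !ipBl// !ipZl//.
by rewrite (ipC g f); ring.
Qed.

(** The polynomial t -> ||f - t g||^2 is nonnegative; one well-chosen t suffices. *)
Lemma ip_cauchy_schwarz f g : sqint f -> sqint g ->
  ip f g ^+ 2 <= ip f f * ip g g.
Proof.
move=> Lf Lg; have H t := ip_ge0 (fun x => f x - t * g x).
have {}H t : 0 <= ip f f - 2 * t * ip f g + t ^+ 2 * ip g g.
  by rewrite -ip_sqrB.
have gg0 := ip_ge0 g; have ff0 := ip_ge0 f.
have [gg|gg] := eqVneq (ip g g) 0.
  rewrite gg mulr0; have [->|fg] := eqVneq (ip f g) 0; first by rewrite expr0n.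
  (* With <g, g> = 0 the polynomial is affine in t; at this t it would equal -1. *)
  have := H ((ip f f + 1) / (2 * ip f g)).
  rewrite gg mulr0 addr0.
  have -> : 2 * ((ip f f + 1) / (2 * ip f g)) * ip f g = ip f f + 1.
    by field.
  by lra.
(* The minimiser of the polynomial. *)
have := H (ip f g / ip g g).
have -> : ip f f - 2 * (ip f g / ip g g) * ip f g +
    (ip f g / ip g g) ^+ 2 * ip g g = (ip f f * ip g g - ip f g ^+ 2) / ip g g.
  by field.
by rewrite pmulr_lge0 ?invr_gt0 ?lt_neqAle 1?eq_sym ?gg// subr_ge0.
Qed.

Definition orthonormal (e : nat -> X -> R) :=
  (forall k, sqint (e k)) /\ (forall j k, ip (e j) (e k) = (j == k)%:R).

(** For the projection p of f on the first n vectors, <p, f> and <p, p> both equal the sum of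
    squares, and ||f - p||^2 is nonnegative. *)
Lemma bessel (e : nat -> X -> R) f n : orthonormal e -> sqint f ->
  \sum_(k < n) ip f (e k) ^+ 2 <= ip f f.
Proof.
move=> [Le oe] Lf.
pose p x := \sum_(k < n) ip f (e k) * e k x.
have Lp : sqint p by apply: sqint_sum => k; exact: sqintZ.
have pE g : sqint g -> ip p g = \sum_(k < n) ip f (e k) * ip g (e k).
  move=> Lg; rewrite ip_suml//; last by move=> k; exact: sqintZ.
  by apply: eq_bigr => k _; rewrite ipZl// (ipC g).
have pf : ip p f = \sum_(k < n) ip f (e k) ^+ 2.
  by rewrite pE//; apply: eq_bigr => k _; rewrite expr2.
have pp : ip p p = \sum_(k < n) ip f (e k) ^+ 2.
  rewrite pE//; apply: eq_bigr => k _; rewrite expr2; congr (_ * _).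
  rewrite ip_suml//; last by move=> j; exact: sqintZ.
  under eq_bigr do rewrite ipZl// oe.
  rewrite (bigD1 k)//= eqxx mulr1 big1 ?addr0// => j jk.
  by rewrite (_ : (_ == _) = false) ?mulr0//; apply/negbTE.
have := ip_ge0 (fun x => f x - 1 * p x).
by rewrite ip_sqrB// (ipC f p) pf pp; lra.
Qed.

End SquareIntegrable.

(** * Hilbert-Schmidt kernel operators *)

Section Tensor.
Context {d} {X : measurableType d} {R : realType} (mu : probability X R).

Lemma measurable_tensor (F G : X -> R) :
  measurable_fun setT F -> measurable_fun setT G ->
  measurable_fun setT (fun z : X * X => F z.1 * G z.2).
Proof.
move=> mF mG; apply: measurable_funM.
  by apply: (measurableT_comp mF); exact: measurable_fst.
by apply: (measurableT_comp mG); exact: measurable_snd.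
Qed.

Lemma integrable_tensor (F G : X -> R) :
  mu.-integrable setT (EFin \o F) -> mu.-integrable setT (EFin \o G) ->
  (mu \x mu)%E.-integrable setT (EFin \o (fun z => F z.1 * G z.2)).
Proof.
move=> iF iG.
have mF : measurable_fun setT F by apply/measurable_EFinP; exact: measurable_int iF.
have mG : measurable_fun setT G by apply/measurable_EFinP; exact: measurable_int iG.
have [_ aF] := integrableP _ _ _ iF; have [_ aG] := integrableP _ _ _ iG.
apply/integrable12ltyP.
  by apply/measurable_EFinP; exact: measurable_tensor.
have G0 : (0 <= \int[mu]_y `|(G y)%:E|)%E by exact: integral_ge0.
rewrite (eq_integral (fun x => `|(F x)%:E| * \int[mu]_y `|(G y)%:E|)%E); last first.
  move=> x _; rewrite -ge0_integralZl//.
  - by apply: eq_integral => y _ /=; rewrite -EFinM normrM.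
  - by apply: measurableT_comp => //; exact/measurable_EFinP.
rewrite ge0_integralZr//; last first.
  by apply: measurableT_comp => //; exact/measurable_EFinP.
apply: lte_mul_pinfty => //; first exact: integral_ge0.
by rewrite ge0_fin_numE//; exact: integral_ge0.
Qed.

Lemma Rintegral_tensor (F G : X -> R) :
  mu.-integrable setT (EFin \o F) -> mu.-integrable setT (EFin \o G) ->
  (\int[(mu \x mu)%E]_z (F z.1 * G z.2) = (\int[mu]_x F x) * \int[mu]_y G y)%R.
Proof.
move=> iF iG; rewrite /Rintegral -fineM; [|exact: integrable_fin_num..].
congr fine.
rewrite -(integral12_prod_meas1 (integrable_tensor iF iG)) /fubini_F /=.
have G_fin : (\int[mu]_y (G y)%:E)%E \is a fin_num by exact: integrable_fin_num.
rewrite (eq_integral (fun x => (F x)%:E * \int[mu]_y (G y)%:E)%E); last first.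
  move=> x _; rewrite -integralZl//.
by rewrite -{1}(fineK G_fin) integralZr// (fineK G_fin).
Qed.

Lemma sqint_tensor (f g : X -> R) : sqint mu f -> sqint mu g ->
  sqint (mu \x mu)%E (fun z => f z.1 * g z.2).
Proof.
move=> [mf f2] [mg g2]; split; first exact: measurable_tensor.
have := integrable_tensor f2 g2.
by apply: eq_integrable => // z _ /=; rewrite exprMn.
Qed.

Lemma ip_tensor (f g f' g' : X -> R) :
  sqint mu f -> sqint mu g -> sqint mu f' -> sqint mu g' ->
  ip (mu \x mu)%E (fun z => f z.1 * g z.2) (fun z => f' z.1 * g' z.2) =
  ip mu f f' * ip mu g g'.
Proof.
move=> Lf Lg Lf' Lg'; rewrite /ip.
rewrite -(Rintegral_tensor (sqintM Lf Lf') (sqintM Lg Lg')).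
by apply: eq_Rintegral => z _; rewrite mulrACA.
Qed.

Lemma sqint_cst (a : R) : sqint mu (cst a).
Proof.
split => //; apply: (@finite_measure_integrable_cst _ _ _ mu _ (a ^+ 2)) => //.
Qed.

Lemma sqint_bounded (f : X -> R) (M : R) : measurable_fun setT f ->
  (forall x, `|f x| <= M) -> sqint mu f.
Proof.
move=> mf fM; apply: (le_sqint mf (sqint_cst M)) => x.
by rewrite (le_trans (fM x))// ler_norm.
Qed.

Lemma sqint_indic (A : set X) : measurable A -> sqint mu \1_A.
Proof.
move=> mA; apply: (@sqint_bounded _ 1) => // x.
by rewrite indicE; case: (_ \in _); rewrite ?normr1 ?normr0.
Qed.

Lemma sqint_integrable (f : X -> R) : sqint mu f ->
  mu.-integrable setT (EFin \o f).
Proof.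
move=> Lf; have := sqintM Lf (sqint_cst 1).
by apply: eq_integrable => // x _ /=; rewrite mulr1.
Qed.

End Tensor.

(* The kernel operator; where [c x \* f] is not integrable its value is junk,
   which only happens on a null set of [x]. *)
Definition kop {d} {X : measurableType d} {R : realType} (mu : probability X R)
    (c : X -> X -> R) (f : X -> R) : X -> R := fun x => ip mu (c x) f.

Section KernelOperator.
Context {d} {X : measurableType d} {R : realType} (mu : probability X R).
Variable c : X -> X -> R.
Local Notation T := (kop mu c).
Local Notation c2 := (fun z : X * X => c z.1 z.2).
Hypothesis c_sqint : sqint (mu \x mu)%E c2.

Lemma measurable_kernel_row x : measurable_fun setT (c x).
Proof. by case: c_sqint => mc _; exact: (measurable_fun_pair2 x mc). Qed.

Lemma ae_sqint_kernel_row : {ae mu, forall x, sqint mu (c x)}.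
Proof.
case: (c_sqint) => _ /ae_integrable1; apply: filterS => x cx.
by split => //; exact: measurable_kernel_row.
Qed.

Let sqint1 (f : X -> R) : sqint mu f -> sqint (mu \x mu)%E (fun z => f z.2).
Proof.
move=> Lf; have := sqint_tensor (sqint_cst mu 1) Lf.
by under eq_fun do rewrite /= mul1r.
Qed.

Lemma measurable_kop f : sqint mu f -> measurable_fun setT (T f).
Proof.
move=> Lf; have /measurable_fubini_F := sqintM c_sqint (sqint1 Lf).
by move=> /(measurableT_comp (fine_measurable measurableT)).
Qed.

(** Cauchy-Schwarz on almost every row gives (T f)(x)^2 <= ||c(x, .)||^2 ||f||^2; Tonelli integrates
    this in x. *)
Lemma sqint_kop f : sqint mu f -> sqint mu (T f).
Proof.
move=> Lf; have mT := measurable_kop Lf; split => //; apply/integrableP.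
have mT2 : measurable_fun setT (EFin \o (fun x => T f x ^+ 2)).
  by apply/measurable_EFinP; exact: measurable_funX.
split => //; case: (c_sqint) => mc c2i.
have [_ c2oo] := integrableP _ _ _ c2i.
pose q : X * X -> \bar R := EFin \o (fun z => c z.1 z.2 ^+ 2).
have mc2 : measurable_fun setT q.
  by apply/measurable_EFinP; exact: measurable_funX.
have mF := measurable_fun_fubini_tonelli_F (m2 := mu) _ mc2 (fun=> sqr_ge0 _).
have F0 x : (0 <= fubini_F mu q x)%E.
  by apply: integral_ge0 => y _; rewrite lee_fin sqr_ge0.
apply: (@le_lt_trans _ _ (\int[mu]_x ((ip mu f f)%:E *
    fubini_F mu q x))%E).
  apply: ae_ge0_le_integral => //.
  - by apply: measurableT_comp.
  - by move=> x _; rewrite mule_ge0// lee_fin ip_ge0.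
  - exact: measurable_funeM.
  - apply: filterS ae_sqint_kernel_row => x Lx _.
    rewrite gee0_abs ?lee_fin ?sqr_ge0//.
    apply: (@le_trans _ _ ((ip mu f f)%:E * (ip mu (c x) (c x))%:E)%E).
      by rewrite -EFinM lee_fin mulrC; exact: ip_cauchy_schwarz.
    rewrite (EFin_ip Lx Lx) /fubini_F /=.
    rewrite lee_wpmul2l ?lee_fin ?ip_ge0//.
rewrite ge0_integralZl//; last by rewrite lee_fin ip_ge0.
rewrite lte_mul_pinfty ?lee_fin ?ip_ge0// -fubini_tonelli1//; last first.
  by move=> z; rewrite lee_fin sqr_ge0.
apply: le_lt_trans c2oo; apply: ge0_le_integral => //.
- by move=> z _; rewrite lee_fin sqr_ge0.
- by apply: measurableT_comp.
- by move=> z _; exact: lee_abs.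
Qed.

Lemma sqint_iter_kop n f : sqint mu f -> sqint mu (iter n T f).
Proof. by move=> Lf; elim: n => //= n IH; exact: sqint_kop. Qed.

(** Fubini turns <T f, g> into a pairing with the kernel on the square, where the L2 convergence of
    its expansion is available. *)
Lemma ip_kop f g : sqint mu f -> sqint mu g ->
  ip mu (T f) g = ip (mu \x mu)%E c2 (fun z => g z.1 * f z.2).
Proof.
move=> Lf Lg; have i := sqintM c_sqint (sqint_tensor Lg Lf).
rewrite [RHS]/ip /Rintegral -(integral12_prod_meas1 i); congr fine.
apply: ae_eq_integral => //.
- apply/measurable_EFinP; apply: measurable_funM; first exact: measurable_kop.
  by case: Lg.
- exact: (measurable_fubini_F i).
- apply: filterS ae_sqint_kernel_row => x Lx _.
  have iTf := sqintM Lx Lf.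
  rewrite /fubini_F /= EFinM /kop (EFin_ip Lx Lf) muleC -integralZl//; apply: eq_integral => y _.
  by rewrite /= -EFinM; congr EFin; ring.
Qed.

End KernelOperator.

(** Valid at every x, even where the defining integral is infinite, because [fine] then returns 0.
    Nonnegativity without exceptions lets the iterates serve as densities. *)
Lemma kop_ge0 {d} {X : measurableType d} {R : realType} (mu : probability X R)
    (c : X -> X -> R) (f : X -> R) : (forall x y, 0 <= c x y) ->
  (forall x, 0 <= f x) -> forall n x, 0 <= iter n (kop mu c) f x.
Proof.
move=> c0 f0; elim=> //= n IH x.
by apply: Rintegral_ge0 => y _; rewrite mulr_ge0.
Qed.

Section Expansion.
Context {d} {X : measurableType d} {R : realType} (mu : probability X R).
Variables (e : nat -> X -> R) (lam : nat -> R) (c : X -> X -> R).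
Hypothesis e_on : orthonormal mu e.
Local Notation T := (kop mu c).
Local Notation c2 := (fun z : X * X => c z.1 z.2).

Let S n (z : X * X) := \sum_(k < n) lam k * e k z.1 * e k z.2.

Definition expansion := measurable_fun setT c2 /\
  ((\int[mu \x mu]_z ((\sum_(k < n) lam k * e k z.1 * e k z.2 - c z.1 z.2) ^+ 2)%:E)
    @[n --> \oo] --> 0)%E.

Hypothesis c_exp : expansion.

Let sqint_e k : sqint mu (e k). Proof. by case: e_on. Qed.

Let sqint_term k :
  sqint (mu \x mu)%E (fun z : X * X => lam k * e k z.1 * e k z.2).
Proof. exact: (sqint_tensor (sqintZ (lam k) (sqint_e k)) (sqint_e k)). Qed.

Let sqint_S n : sqint (mu \x mu)%E (S n).
Proof.
have := sqint_sum (index_iota 0 n) sqint_term.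
by under eq_fun do rewrite big_mkord.
Qed.

Let fine_exp :
  (\forall n \near \oo, (\int[mu \x mu]_z ((S n z - c2 z) ^+ 2)%:E)%E \is a fin_num) /\
  (fine (\int[mu \x mu]_z ((S n z - c2 z) ^+ 2)%:E)%E @[n --> \oo] --> 0).
Proof. by case: c_exp => _ /fine_cvgP. Qed.

(** c = S_N - (S_N - c) for one N at which the L2 distance is finite; convergence to 0 grants this
    only for large N. *)
Lemma sqint_expansion : sqint (mu \x mu)%E c2.
Proof.
case: c_exp => mc _; have [[N _ /(_ N (leqnn _)) SN] _] := fine_exp.
have [mS _] := sqint_S N.
have mD : measurable_fun setT (fun z => S N z - c2 z) by exact: measurable_funB.
have LD : sqint (mu \x mu)%E (fun z => S N z - c2 z).
  split => //; apply/integrableP; split.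
    by apply/measurable_EFinP; exact: measurable_funX.
  under eq_integral do rewrite /= ger0_norm ?sqr_ge0//.
  by move/fin_numPlt: SN => /andP[].
have := sqintB (sqint_S N) LD.
by under eq_fun do rewrite opprB addrC subrK.
Qed.
Let Lc := sqint_expansion.

(** The partial sums are pairings of the truncated kernels with g(x) f(y), so Cauchy-Schwarz on the
    square transfers the L2 convergence. *)
Lemma cvg_ip_kop f g : sqint mu f -> sqint mu g ->
  \sum_(k < n) lam k * ip mu f (e k) * ip mu g (e k) @[n --> \oo]
    --> ip mu (T f) g.
Proof.
move=> Lf Lg; rewrite (ip_kop Lc Lf Lg).
pose h z := g z.1 * f z.2.
have Lh : sqint (mu \x mu)%E h by exact: sqint_tensor.
have SE n : \sum_(k < n) lam k * ip mu f (e k) * ip mu g (e k)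
    = ip (mu \x mu)%E (S n) h.
  rewrite /S -(big_mkord xpredT (fun k => lam k * ip mu f (e k) * ip mu g (e k))).
  transitivity (ip (mu \x mu)%E
      (fun z => \sum_(0 <= k < n) lam k * e k z.1 * e k z.2) h); last first.
    by congr ip; apply/funext => z; rewrite big_mkord.
  rewrite (ip_suml (index_iota 0 n) sqint_term Lh); apply: eq_bigr => k _.
  rewrite (ip_tensor (sqintZ (lam k) (sqint_e k)) (sqint_e k) Lg Lf).
  by rewrite ipZl// (ipC _ g) (ipC _ f); ring.
have K0 : 0 <= ip (mu \x mu)%E h h by exact: ip_ge0.
pose D n := fine (\int[mu \x mu]_z ((S n z - c2 z) ^+ 2)%:E)%E.
apply/cvgrPdist_lt => eps eps0.
(* The added 1 keeps the denominator positive when h vanishes almost everywhere. *)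
have [_ /cvgrPdist_lt/(_ (eps ^+ 2 / (ip (mu \x mu)%E h h + 1)))] := fine_exp.
have -> : 0 < eps ^+ 2 / (ip (mu \x mu)%E h h + 1).
  by rewrite divr_gt0 ?exprn_gt0// ltr_wpDl.
move=> /(_ isT); apply: filterS => n.
rewrite sub0r normrN => Dn.
rewrite SE distrC -ipBl// -(@ltr_pXn2r _ 2)// ?nnegrE ?ltW// real_normK ?num_real//.
apply: le_lt_trans (ip_cauchy_schwarz _ Lh) _; first exact: sqintB.
have -> : ip (mu \x mu)%E (fun x => S n x - c2 x) (fun x => S n x - c2 x) = D n.
  by rewrite /ip; apply: eq_Rintegral => z _; rewrite -expr2.
apply: (@le_lt_trans _ _ (`|D n| * (ip (mu \x mu)%E h h + 1))).
  by rewrite ler_pM ?ler_norm ?lerDl// /D fine_ge0// integral_ge0// => z _;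
     rewrite lee_fin sqr_ge0.
by rewrite -ltr_pdivlMr// ltr_wpDl.
Qed.

(** Both sides are limits of the same partial sums, which are symmetric in f and g. *)
Lemma kop_sym f g : sqint mu f -> sqint mu g -> ip mu (T f) g = ip mu f (T g).
Proof.
move=> Lf Lg; rewrite (ipC mu f).
apply: cvg_unique (cvg_ip_kop Lf Lg) _ => //.
have := cvg_ip_kop Lg Lf.
by under eq_fun do under eq_bigr do rewrite mulrAC.
Qed.

Lemma kop_eigen f k : sqint mu f ->
  ip mu (T f) (e k) = lam k * ip mu f (e k).
Proof.
move=> Lf; apply: cvg_unique (cvg_ip_kop Lf (sqint_e k)) _ => //.
apply: cvg_near_cst; exists k.+1 => // n /= kn.
case: e_on => _ oe; rewrite (bigD1 (Ordinal kn))//= oe eqxx mulr1.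
rewrite big1 ?addr0// => j jk; rewrite oe eq_sym.
by rewrite (_ : (_ == _) = false) ?mulr0//; apply/negbTE.
Qed.

Lemma iter_kop_eigen f k n : sqint mu f ->
  ip mu (iter n T f) (e k) = lam k ^+ n * ip mu f (e k).
Proof.
move=> Lf; elim: n => [|n IH]; first by rewrite expr0 mul1r.
by rewrite iterS (kop_eigen k (sqint_iter_kop Lc n Lf)) IH exprS mulrA.
Qed.

(** One factor T provides the expansion, the other m - 1 become powers of the coefficients. At m = 0
    the claim would be Parseval's identity, that is, completeness. *)
Lemma cvg_ip_iter_kop f g m : sqint mu f -> sqint mu g -> (0 < m)%N ->
  \sum_(k < n) lam k ^+ m * ip mu f (e k) * ip mu g (e k) @[n --> \oo]
    --> ip mu (iter m T f) g.
Proof.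
case: m => // m Lf Lg _; have := cvg_ip_kop (sqint_iter_kop Lc m Lf) Lg.
by under eq_fun do under eq_bigr do rewrite iter_kop_eigen// mulrA -exprS.
Qed.

Lemma iter_kop_sym f g n : sqint mu f -> sqint mu g ->
  ip mu (iter n T f) g = ip mu f (iter n T g).
Proof.
move=> Lf Lg; elim: n g Lg => //= n IH g Lg.
rewrite (kop_sym (sqint_iter_kop Lc n Lf) Lg) (IH _ (sqint_kop Lc Lg)).
by rewrite -iterSr.
Qed.

(** The term of index 0 is the subtracted product; the others are bounded by |ab| <= (a^2 + b^2) / 2
    and Bessel. For f = g of norm 1 the bound is exactly s, as the value of rho_n requires. *)
Lemma iter_kop_dist f g m (s : R) : sqint mu f -> sqint mu g -> (0 < m)%N ->
  lam 0 = 1 -> (forall k, `|lam k.+1| ^+ m <= s) ->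
  `|ip mu (iter m T f) g - ip mu f (e 0) * ip mu g (e 0)| <=
  s * ((ip mu f f + ip mu g g) / 2).
Proof.
move=> Lf Lg m0 lam0 lams.
have H := cvg_ip_iter_kop Lf Lg m0.
have /cvg_norm {}H : \sum_(k < n) lam k ^+ m * ip mu f (e k) * ip mu g (e k)
    - ip mu f (e 0) * ip mu g (e 0) @[n --> \oo]
    --> ip mu (iter m T f) g - ip mu f (e 0) * ip mu g (e 0).
  by apply: cvgB => //; exact: cvg_cst.
rewrite -(cvg_lim _ H)//; apply: limr_le; first by apply/cvg_ex; eexists; exact: H.
exists 1%N => // -[//|n] _ /=.
rewrite big_ord_recl lam0 expr1n mul1r addrAC subrr add0r.
apply: le_trans (ler_norm_sum _ _ _) _.
have s0 : 0 <= s by apply: le_trans (lams 0); rewrite exprn_ge0.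
apply: (@le_trans _ _ (\sum_(i < n) s *
    ((ip mu f (e i.+1) ^+ 2 + ip mu g (e i.+1) ^+ 2) / 2))).
  apply: ler_sum => i _; rewrite -mulrA normrM normrX.
  apply: ler_pM; rewrite ?exprn_ge0//; first exact: lams.
  rewrite ler_norml; apply/andP; split;
    move: (ip mu f _) (ip mu g _) => a b;
    have := sqr_ge0 (a - b); have := sqr_ge0 (a + b); rewrite !expr2; nra.
rewrite -mulr_sumr ler_wpM2l// -mulr_suml ler_wpM2r ?invr_ge0//.
have B f' : sqint mu f' -> \sum_(i < n) ip mu f' (e i.+1) ^+ 2 <= ip mu f' f'.
  move=> Lf'; apply: le_trans (bessel n.+1 e_on Lf').
  by rewrite [leRHS]big_ord_recl lerDr sqr_ge0.
by rewrite big_split/= lerD// B.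
Qed.

End Expansion.

(** * Measure-theoretic complements *)

Section ChangeOfDensity.
Local Open Scope ereal_scope.
Context {d1 d2} {O : measurableType d1} {Y : measurableType d2} {R : realType}.
Variables (P : {measure set O -> \bar R}) (mu : {measure set Y -> \bar R}).
Variables (w : O -> R) (x : O -> Y) (h : Y -> R).
Hypotheses (mw : measurable_fun setT w) (w0 : forall o, (0 <= w o)%R).
Hypotheses (mh : measurable_fun setT h) (h0 : forall y, (0 <= h y)%R).
Hypothesis mx : measurable_fun setT x.
Hypothesis H : forall A, measurable A ->
  \int[P]_o ((w o)%:E * (\1_A (x o))%:E) = \int[mu]_y ((h y)%:E * (\1_A y)%:E).

Import HBNNSimple.

Let density_nnsfun (g : {nnsfun Y >-> R}) :
  \int[P]_o ((w o)%:E * (g (x o))%:E) = \int[mu]_y ((h y)%:E * (g y)%:E).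
Proof.
have E (d' : measure_display) (Z : measurableType d')
    (m : {measure set Z -> \bar R}) (u : Z -> R) (y : Z -> Y) :
    measurable_fun setT u -> (forall z, 0 <= u z)%R -> measurable_fun setT y ->
    \int[m]_z ((u z)%:E * (g (y z))%:E) =
    \sum_(r \in range g) (r%:E * \int[m]_z ((u z)%:E * (\1_(g @^-1` [set r]) (y z))%:E)).
  move=> mu' u0 my.
  have mi r : measurable_fun setT (fun z => (\1_(g @^-1` [set r]) (y z) : R)).
    by apply: (measurableT_comp _ my); exact: measurable_indic.
  transitivity (\int[m]_z (\sum_(r \in range g)
      ((u z)%:E * (r%:E * (\1_(g @^-1` [set r]) (y z))%:E)))).
    apply: eq_integral => z _; rewrite fimfunE -fsumEFin// ge0_mule_fsumr//.
    by move=> r; rewrite EFinM; exact: (nnfun_muleindic_ge0 g).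
  rewrite ge0_integral_fsum//; last 2 first.
  - move=> r; apply: emeasurable_funM; first exact/measurable_EFinP.
    by apply: measurable_funeM; exact/measurable_EFinP.
  - by move=> r z _; rewrite mule_ge0 ?lee_fin//; exact: (nnfun_muleindic_ge0 g).
  apply: eq_fsbigr => r /set_mem[y' _ <-].
  rewrite -ge0_integralZl//; last 3 first.
  - by apply: emeasurable_funM; exact/measurable_EFinP.
  - by move=> z _; rewrite mule_ge0 ?lee_fin.
  - by rewrite lee_fin.
  by apply: eq_integral => z _; rewrite muleCA.
rewrite (E _ O P w x)// (E _ Y mu h id)//.
by apply: eq_fsbigr => r _; rewrite H.
Qed.

(** Hypothesis [H] says that the image under x of the measure w dP has density h with respect to mu;
    simple functions and monotone convergence extend it to g. With w a function of U_0 and x = U_n,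
    the function h is the conditional expectation of w given U_n. *)
Lemma change_of_density (g : Y -> \bar R) :
  measurable_fun setT g -> (forall y, 0 <= g y) ->
  \int[P]_o ((w o)%:E * g (x o)) = \int[mu]_y ((h y)%:E * g y).
Proof.
move=> mg g0; pose f_ := nnsfun_approx measurableT mg.
have E (d' : measure_display) (Z : measurableType d')
    (m : {measure set Z -> \bar R}) (u : Z -> R) (y : Z -> Y) :
    measurable_fun setT u -> (forall z, 0 <= u z)%R -> measurable_fun setT y ->
    \int[m]_z ((u z)%:E * g (y z)) =
    limn (fun n => \int[m]_z ((u z)%:E * (f_ n (y z))%:E)).
  move=> mu' u0 my; rewrite -monotone_convergence//=.
  - apply: eq_integral => z _; apply/esym/cvg_lim => //=.
    by apply: cvgeZl => //; exact: cvg_nnsfun_approx.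
  - move=> n; apply: emeasurable_funM; first exact/measurable_EFinP.
    by apply/measurable_EFinP; exact: measurableT_comp.
  - by move=> n z _; rewrite mule_ge0 ?lee_fin.
  - move=> z _ a b ab; rewrite lee_wpmul2l ?lee_fin//.
    exact/lefP/nd_nnsfun_approx.
rewrite (E _ O P w x)// (E _ Y mu h id)//.
by congr (limn _); apply/funext => n; rewrite density_nnsfun.
Qed.

End ChangeOfDensity.

(** Rays are closed under intersection and generate the Borel sets. Rational endpoints matter
    because the equalities will hold only almost everywhere in a parameter, and only countably many
    can be combined. *)
Lemma eq_measure_rat_rays (R : realType)
    (m1 m2 : {measure set (measurableTypeR R) -> \bar R}) :
  (m1 setT < +oo)%E ->
  (forall q : rat, m1 `]-oo, ratr q]%classic = m2 `]-oo, ratr q]%classic) ->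
  forall A, measurable A -> m1 A = m2 A.
Proof.
move=> m1oo m12 A mA.
pose G : set (set R) := range (fun q : rat => `]-oo, ratr q]%classic).
have mray (q : rat) : measurable (`]-oo, ratr q]%classic : set (measurableTypeR R)).
  exact: measurable_itv.
apply: (measure_unique (T := measurableTypeR R) G
  (fun n : nat => `]-oo, ratr n%:Q]%classic)) mA => //.
- rewrite (RGenInftyO.measurableE R); apply/seteqP; split; apply: smallest_sub.
  + exact: smallest_sigma_algebra.
  + move=> _ [x ->].
    have -> : `]-oo, x[%classic = \bigcup_(q : rat)
        (if ratr q < x then `]-oo, ratr q]%classic else set0) :> set R.
      apply/seteqP; split=> [y /= |y [q _]]; last first.
        by case: ifPn => // qx; rewrite /= !in_itv/= => /le_lt_trans; exact.
      rewrite in_itv/= => yx; have [q] := rat_in_itvoo yx.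
      rewrite in_itv/= => /andP[yq qx]; exists q => //.
      by rewrite qx /= ?in_itv /= ltW.
    apply: (@bigcupT_measurable_rat _ (g_sigma_algebraType G)) => q.
    case: ifPn => _; last exact: measurable0.
    by apply: sub_sigma_algebra; exists q.
  + exact: smallest_sigma_algebra.
  + move=> _ [q _ <-]; rewrite -(RGenInftyO.measurableE R); exact: mray.
- move=> _ _ [q _ <-] [r _ <-]; exists (Num.min q r) => //.
  apply/seteqP; split=> y; rewrite /= !in_itv/=.
    move=> yqr; split; apply: (le_trans yqr);
      by rewrite ler_rat ge_min lexx ?orbT.
  by move=> -[yq yr]; rewrite /Num.min; case: ifPn.
- by move=> n; exists n%:Q.
- apply/seteqP; split=> // y _; exists (Num.truncn `|y|).+1 => //=.
  rewrite in_itv/= ratr_int; apply: le_trans (ler_norm _) _.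
  by apply: ltW; exact: truncnS_gt.
- by move=> _ [q _ <-]; exact: m12.
- move=> n; apply: le_lt_trans m1oo; apply: le_measure => //.
    by rewrite inE; exact: mray.
  by rewrite inE.
Qed.

(* Unlike [ae_eq_integral], no measurability is assumed: simple functions may
   be cut off on the exceptional set without changing their integrals. *)
Section NullSets.
Local Open Scope ereal_scope.
Context {d} {X : measurableType d} {R : realType}.
Variable mu : {measure set X -> \bar R}.

Import HBNNSimple.

Let ge0_le_integral_null (f g : X -> \bar R) (N : set X) :
  measurable N -> mu N = 0 -> (forall x, 0 <= f x) -> (forall x, 0 <= g x) ->
  (forall x, ~ N x -> f x = g x) -> \int[mu]_x f x <= \int[mu]_x g x.
Proof.
move=> mN N0 f0 g0 fg; rewrite !ge0_integralTE//=.
apply: ge_ereal_sup => _ [h /= hf <-].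
pose k := proj_nnsfun h (measurableC mN).
have kE x : k x = (h x * \1_(~` N) x)%R by [].
apply: le_ereal_sup_tmp; exists (sintegral mu k); last first.
  rewrite -!integralT_nnsfun le_eqVlt; apply/orP; left; apply/eqP.
  apply: ae_eq_integral => //; try exact/measurable_EFinP.
  exists N; split => // x /=; apply: contra_notP => Nx _.
  transitivity ((h x * \1_(~` N) x)%:E) => //.
  by rewrite indicE mem_set// mulr1.
exists k => // x; rewrite [k x]kE indicE.
have [xN|xN] := boolP (x \in ~` N); last by rewrite mulr0.
by rewrite mulr1 -fg//; move: xN; rewrite inE.
Qed.

Lemma ae_eq_integral_null (f g : X -> \bar R) (D : set X) :
  ae_eq mu D f g -> \int[mu]_(x in D) f x = \int[mu]_(x in D) g x.
Proof.
move=> [N [mN N0 sub]]; rewrite integral_mkcond [RHS]integral_mkcond.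
rewrite integralE [RHS]integralE.
have fg x : ~ N x -> (f \_ D) x = (g \_ D) x.
  move=> Nx; rewrite !patchE; case: ifPn => // /set_mem Dx.
  by move/subsetCl : sub; apply.
have E (u v : X -> \bar R) : (forall x, 0 <= u x) -> (forall x, 0 <= v x) ->
    (forall x, ~ N x -> u x = v x) -> \int[mu]_x u x = \int[mu]_x v x.
  move=> u0 v0 uv; apply/eqP; rewrite eq_le !(@ge0_le_integral_null _ _ N)//.
  by move=> x Nx; rewrite uv.
congr (_ - _); apply: E => [x|x|x Nx].
- exact: funepos_ge0.
- exact: funepos_ge0.
- by rewrite !funeposE fg.
- exact: funeneg_ge0.
- exact: funeneg_ge0.
- by rewrite !funenegE fg.
Qed.

End NullSets.

Section Density.
Local Open Scope ereal_scope.
Context {d} {X : measurableType d} {R : realType} (mu : {measure set X -> \bar R}).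
Variable f : X -> R.
Hypotheses (mf : measurable_fun setT f) (f0 : forall x, (0 <= f x)%R).

(** The proofs are carried as arguments so that the measure structure can be attached canonically to
    the term. *)
Definition density_measure of measurable_fun setT f & (forall x, (0 <= f x)%R) :=
  fun A : set X => \int[mu]_(x in A) (f x)%:E.

Local Notation m := (density_measure mf f0).

Let m0 : m set0 = 0. Proof. exact: integral_set0. Qed.

Let m_ge0 A : 0 <= m A.
Proof. by apply: integral_ge0 => x _; rewrite lee_fin. Qed.

Let m_sigma_additive : semi_sigma_additive m.
Proof.
move=> /= F mF tF mUF; rewrite /density_measure; apply: cvg_toP.
  by apply: ereal_nondecreasing_is_cvgn => p q pq;
    apply: lee_sum_nneg_natr => // k _ _; exact: m_ge0.
rewrite ge0_integral_bigcup//=.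
- by apply: measurable_funTS; exact/measurable_EFinP.
- by move=> x _; rewrite lee_fin.
Qed.

HB.instance Definition _ := isMeasure.Build _ _ _ m m0 m_ge0 m_sigma_additive.

End Density.

Section DensityProbability.
Context {d} {X : measurableType d} {R : realType} (mu : {measure set X -> \bar R}).
Variable f : X -> R.
Hypotheses (mf : measurable_fun setT f) (f0 : forall x, (0 <= f x)%R).

Definition density_prob of (\int[mu]_x (f x)%:E = 1)%E := density_measure mu mf f0.

Hypothesis f1 : (\int[mu]_x (f x)%:E = 1)%E.

HB.instance Definition _ := Measure.on (density_prob f1).
HB.instance Definition _ :=
  @Measure_isProbability.Build _ _ R (density_prob f1) f1.

End DensityProbability.

Lemma integral_unif {R : realType} (F : measurableTypeR R -> \bar R) :
  measurable_fun setT F ->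
  (\int[unif R]_x F x = \int[@lebesgue_measure R]_(x in `[0%R, 1%R]) F x)%E.
Proof.
move=> mF; rewrite integralE [RHS]integralE /unif.
rewrite !integral_uniform//; try exact: measurable_funepos; try exact: measurable_funeneg.
by rewrite subr0 invr1 !mul1e.
Qed.

Lemma Rintegral_unif {R : realType} (F : R -> R) :
  measurable_fun setT F ->
  (\int[unif R]_x F x = \int[@lebesgue_measure R]_(x in `[0, 1]) F x)%R.
Proof.
by move=> mF; rewrite /Rintegral integral_unif//; exact/measurable_EFinP.
Qed.

(** * The copula *)

Section UnitSquare.
Context {R : realType}.
Local Notation leb := (@lebesgue_measure R).
Local Notation I01 := (`[0%R, 1%R]%classic : set R).
Local Notation M := (measurableTypeR R).

Let mI : measurable (I01 : set M). Proof. exact: measurable_itv. Qed.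

(** Tonelli on both sides reduces this to the one-dimensional formula, applied in each variable. *)
Lemma integral_unif2 (G : M * M -> \bar R) :
  measurable_fun setT G -> (forall z, 0 <= G z)%E ->
  (\int[unif R \x unif R]_z G z = \int[leb \x leb]_(z in I01 `*` I01) G z)%E.
Proof.
move=> mG G0; rewrite fubini_tonelli1//.
rewrite integral_unif; last exact: (measurable_fun_fubini_tonelli_F G mG G0).
have mII : measurable (I01 `*` I01 : set (M * M)) by exact: measurableX.
rewrite [RHS]integral_mkcond fubini_tonelli1//; last 2 first.
- by have := (measurable_restrictT G mII).1 (measurable_funTS mG).
- by move=> z; rewrite patchE; case: ifPn.
rewrite integral_mkcond; apply: eq_integral => x _; rewrite patchE /fubini_F.
case: ifPn => xI.
  rewrite integral_unif; last exact: (measurable_fun_pair2 x mG).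
  rewrite [LHS]integral_mkcond; apply: eq_integral => y _; rewrite !patchE.
  by rewrite in_setX /= xI.
by apply/esym; apply: integral0_eq => y _; rewrite patchE in_setX /= (negbTE xI).
Qed.

Variables (lambda : nat -> R) (phi : nat -> R -> R) (c : R -> R -> R).
Hypothesis h_on : orthonormal_system (with_one phi).

Definition restr_basis (k : nat) : M -> R := with_one phi k \_ I01.
Definition with_one_coef (k : nat) : R := if k is j.+1 then lambda j else 1.
Definition restr_kernel (x y : M) : R :=
  ((fun z : M * M => c z.1 z.2) \_ (I01 `*` I01)) (x, y).

Local Notation e := restr_basis.
Local Notation lam := with_one_coef.

Lemma measurable_restr_basis k : measurable_fun setT (e k).
Proof. by case: h_on => mp _; exact: ((measurable_restrictT _ mI).1 (mp k)). Qed.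

Lemma EFin_integral_restr_basis j k :
  (\int[unif R]_x (e j x * e k x)%:E = (j == k)%:R%:E)%E.
Proof.
case: h_on => _ /(_ j k) <-.
rewrite integral_unif; last first.
  apply/measurable_EFinP.
  by apply: measurable_funM; exact: measurable_restr_basis.
by apply: eq_integral => x xI; rewrite /e !patchE xI.
Qed.

Lemma orthonormal_restr_basis : orthonormal (unif R) e.
Proof.
split=> [k|j k]; last by rewrite /ip /Rintegral EFin_integral_restr_basis.
split; first exact: measurable_restr_basis.
apply/integrableP; split.
  by apply/measurable_EFinP/measurable_funX; exact: measurable_restr_basis.
under eq_integral do rewrite /= ger0_norm ?sqr_ge0// expr2.
by rewrite EFin_integral_restr_basis ltry.
Qed.

Hypothesis h_c : L2_sum lambda phi c.

Lemma expansion_restr_kernel : expansion (unif R) e lam restr_kernel.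
Proof.
case: h_c => mc cvgc.
have mII : measurable (I01 `*` I01 : set (M * M)) by exact: measurableX.
have mk : measurable_fun setT (fun z : M * M => restr_kernel z.1 z.2).
  have -> : (fun z : M * M => restr_kernel z.1 z.2) =
      (fun z => c z.1 z.2) \_ (I01 `*` I01) by apply/funext => -[].
  exact: ((measurable_restrictT _ mII).1 mc).
(* The shift accounts for the constant term, now the summand of index 0. *)
split => //; rewrite -cvg_shiftS; apply: cvg_trans cvgc.
apply: near_eq_cvg; apply: nearW => n /=.
rewrite integral_unif2//; last 2 first.
- apply/measurable_EFinP/measurable_funX/measurable_funB => //.
  apply: measurable_sum => k.
  have mt : measurable_fun setT (fun x => lam k * e k x).
    by apply: measurable_funM => //; exact: measurable_restr_basis.
  exact: (measurable_tensor mt (measurable_restr_basis k)).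
- by move=> z; rewrite lee_fin sqr_ge0.
apply: eq_integral => -[x y] /[dup] zI; rewrite in_setX/= => /andP[xI yI].
rewrite big_ord_recl/= /e /restr_kernel !patchE xI yI zI /= !mulr1.
by congr ((_ + _ - _) ^+ _)%:E; apply: eq_bigr => k _; rewrite !patchE xI yI.
Qed.

Lemma restr_kernel_ge0 : (forall x y, x \in `[0, 1] -> y \in `[0, 1] -> 0 <= c x y) ->
  forall x y, 0 <= restr_kernel x y.
Proof.
move=> c0 x y; rewrite /restr_kernel patchE; case: ifPn => //.
by rewrite in_setX => /andP[/set_mem xI /set_mem yI]; exact: c0.
Qed.

Lemma ip_restr_basis0 (f : M -> R) : measurable_fun setT f ->
  ip (unif R) f (e 0) = (\int[unif R]_x f x)%R.
Proof.
move=> mf; rewrite /ip !Rintegral_unif//; last first.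
  by apply: measurable_funM => //; exact: measurable_restr_basis.
by apply: eq_Rintegral => x xI; rewrite /e patchE xI/= mulr1.
Qed.

Lemma ip_indic_unif (f : M -> R) (A : set M) : measurable_fun setT f ->
  measurable A ->
  ip (unif R) f \1_A = (\int[leb]_(x in I01 `&` A) f x)%R.
Proof.
move=> mf mA; rewrite /ip Rintegral_unif; last first.
  by apply: measurable_funM => //; exact: measurable_indic.
rewrite Rintegral_mkcond [RHS]Rintegral_mkcond; apply: eq_Rintegral => x _.
rewrite !patchE in_setI indicE; case: ifPn => //= _.
by case: (x \in A); rewrite ?mulr1 ?mulr0.
Qed.

End UnitSquare.

Section Copula.
Context {R : realType}.
Local Notation leb := (@lebesgue_measure R).
Local Notation I01 := (`[0%R, 1%R]%classic : set R).
Local Notation M := (measurableTypeR R).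
Variables (lambda : nat -> R) (phi : nat -> R -> R) (c : R -> R -> R).
Hypothesis h_on : orthonormal_system (with_one phi).
Hypothesis h_c : L2_sum lambda phi c.
Hypothesis c0 : forall x y, x \in `[0, 1] -> y \in `[0, 1] -> 0 <= c x y.

Local Notation mu := (unif R).
Local Notation e := (restr_basis phi).
Local Notation lam := (with_one_coef lambda).
Local Notation k := (restr_kernel c).
Local Notation T := (kop mu k).
Local Notation ray u := (\1_(`]-oo, u]%classic) : M -> R).

Let e_on := orthonormal_restr_basis h_on.
Let k_exp := expansion_restr_kernel h_on h_c.
Let k_sqint := sqint_expansion e_on k_exp.
Let k_ge0 := restr_kernel_ge0 c0.

Lemma measurable_ray (u : R) : measurable (`]-oo, u]%classic : set M).
Proof. exact: measurable_itv. Qed.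

Lemma sqint_ray (u : R) : sqint mu (ray u).
Proof. by apply: sqint_indic; exact: measurable_ray. Qed.

Lemma unit_ray (u : R) : u \in `[0, 1] -> I01 `&` `]-oo, u]%classic = `[0, u]%classic.
Proof.
rewrite in_itv/= => /andP[u0 u1]; apply/seteqP; split=> x; rewrite /= !in_itv/=.
  by move=> [/andP[-> _] ->].
by move=> /andP[x0 xu]; rewrite x0 (le_trans xu).
Qed.

Lemma ip_ray_restr_basisS (u : R) j : u \in `[0, 1] ->
  ip mu (ray u) (e j.+1) = (\int[leb]_(x in `[0, u]) phi j x)%R.
Proof.
move=> uI; rewrite ipC ip_indic_unif//; last exact: (measurable_restr_basis h_on j.+1).
rewrite unit_ray//; apply: eq_Rintegral => x; rewrite inE/= in_itv/= => /andP[x0 xu].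
rewrite /e patchE mem_set//= in_itv/= x0 (le_trans xu)//.
by move: uI; rewrite in_itv/= => /andP[].
Qed.

Lemma ip_ray_restr_basis0 (u : R) : u \in `[0, 1] -> ip mu (ray u) (e 0) = u.
Proof.
move=> uI; have [mr _] := sqint_ray u; rewrite (ip_restr_basis0 h_on mr).
have := @ip_indic_unif R (cst 1) _ (@measurable_cst _ _ _ _ _ _) (measurable_ray u).
rewrite /ip; under eq_Rintegral do rewrite mul1r.
move=> ->; rewrite unit_ray// Rintegral_cst//= mul1r.
move: uI; rewrite in_itv/= => /andP[u0 _]; rewrite lebesgue_measure_itv/= lte_fin.
move: u0; rewrite le_eqVlt => /orP[/eqP <-|->]; first by rewrite ltxx.
by rewrite /= subr0.
Qed.

(** At m = 1 this represents C itself; for general m it represents the claimed formula for C^m. *)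
Lemma series_copulaE m u v : (0 < m)%N -> u \in `[0, 1] -> v \in `[0, 1] ->
  series_copula (fun j => lambda j ^+ m) phi u v = ip mu (iter m T (ray u)) (ray v).
Proof.
move=> m0 uI vI.
have := cvg_ip_iter_kop e_on k_exp (sqint_ray u) (sqint_ray v) m0.
(* Every partial sum now contains the term of index 0, which is u v. *)
rewrite -cvg_shiftS => H.
have {}H : \sum_(i < n.+1) lam i ^+ m * ip mu (ray u) (e i) * ip mu (ray v) (e i)
    - u * v @[n --> \oo] --> ip mu (iter m T (ray u)) (ray v) - u * v.
  by apply: cvgB => //; exact: cvg_cst.
rewrite /series_copula -[RHS](subrK (u * v)) addrC; congr (_ + _).
apply/cvg_lim => //; apply: cvg_trans H; apply: near_eq_cvg; apply: nearW => n /=.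
rewrite /series/= big_mkord big_ord_recl /= expr1n mul1r !ip_ray_restr_basis0//.
rewrite addrC addKr; apply: eq_bigr => j _.
by rewrite !ip_ray_restr_basisS.
Qed.

Lemma ip_one_restr_basis j : ip mu (cst 1) (e j) = (j == 0)%:R.
Proof.
have [Le oe] := e_on; rewrite -oe (ip_restr_basis0 h_on); last by case: (Le j).
by apply: eq_Rintegral => x _; rewrite mul1r.
Qed.

Lemma ip_one (f : M -> R) : sqint mu f -> ip mu (cst 1) f = ip mu f (e 0).
Proof.
move=> [mf _]; rewrite (ip_restr_basis0 h_on mf).
by apply: eq_Rintegral => x _; rewrite mul1r.
Qed.

(** The weak form of T 1 = 1: T is symmetric and e_0 has eigenvalue 1. *)
Lemma ip_kop_one (f : M -> R) : sqint mu f -> ip mu (T (cst 1)) f = ip mu f (e 0).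
Proof.
move=> Lf; have L1 := sqint_cst mu 1; have LTf := sqint_kop k_sqint Lf.
by rewrite (kop_sym e_on k_exp L1 Lf) (ip_one LTf) (kop_eigen e_on k_exp 0 Lf) mul1r.
Qed.

Lemma EFin_ip_indic_restr_basis0 (A : set M) : measurable A ->
  (ip mu (\1_A) (e 0))%:E = mu A.
Proof.
move=> mA; have [mi _] := sqint_indic mu mA.
rewrite (ip_restr_basis0 h_on mi) /Rintegral integral_indic// setIT fineK//.
exact: fin_num_measure.
Qed.

Lemma integral_restr_kernel (A B : set M) : measurable A -> measurable B ->
  (\int[mu \x mu]_(z in A `*` B) (k z.1 z.2)%:E = (ip mu (T \1_B) \1_A)%:E)%E.
Proof.
move=> mA mB; have LA := sqint_indic mu mA; have LB := sqint_indic mu mB.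
rewrite (ip_kop k_sqint LB LA) (EFin_ip k_sqint (sqint_tensor LA LB)).
rewrite [LHS]integral_mkcond; apply: eq_integral => -[x y] _.
rewrite patchE in_setX /= !indicE.
by case: (x \in A); case: (y \in B); rewrite /= ?(mulr0, mulr1).
Qed.

Let T1 : (\int[mu \x mu]_z (k z.1 z.2)%:E = 1)%E.
Proof.
have := integral_restr_kernel measurableT measurableT.
rewrite setXTT => ->; rewrite indicT (ip_kop_one (sqint_cst mu 1)).
by rewrite ip_one_restr_basis.
Qed.

(** The measure with density [k] on the square is the required law; T 1 = 1 yields one marginal, and
    the symmetry of T the other. *)
Lemma is_copula_series : is_copula (series_copula lambda phi).
Proof.
have mk : measurable_fun setT (fun z : M * M => k z.1 z.2) by case: k_exp.
have kz0 (z : M * M) : 0 <= k z.1 z.2 by exact: k_ge0.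
exists (density_prob mk kz0 T1); split => [A mA|A mA|u v uI vI].
- rewrite [LHS](integral_restr_kernel mA measurableT) indicT.
  by rewrite ip_kop_one ?EFin_ip_indic_restr_basis0//; exact: sqint_indic.
- rewrite [LHS](integral_restr_kernel measurableT mA) indicT.
  have LA := sqint_indic mu mA; have L1 := sqint_cst mu 1.
  rewrite (kop_sym e_on k_exp LA L1) ipC (ip_kop_one LA).
  by rewrite EFin_ip_indic_restr_basis0.
- rewrite [LHS](integral_restr_kernel (measurable_ray u) (measurable_ray v)).
  rewrite (kop_sym e_on k_exp (sqint_ray v) (sqint_ray u)) ipC.
  by rewrite -(series_copulaE (m := 1)).
Qed.

(** On [0,1] the function F is the primitive of g cut off to that interval, so Lebesgue
    differentiation applies. *)
Lemma ae_derive1_ip_ray (g : M -> R) (F : R -> R) : sqint mu g ->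
  (forall t, t \in `[0, 1] -> F t = ip mu g (ray t)) ->
  {ae leb, forall t, t \in `]0, 1[ -> derive1 F t = g t}.
Proof.
move=> Lg FE; have [mg _] := Lg.
have mI : measurable (I01 : set M) by exact: measurable_itv.
have ig : leb.-integrable I01 (EFin \o g).
  have /integrableP[mg' goo] := sqint_integrable Lg.
  apply/integrableP; split; first exact: measurable_funTS.
  apply: le_lt_trans goo; rewrite integral_unif//.
  by apply: measurableT_comp.
have ig' : leb.-integrable setT (EFin \o (g \_ I01)).
  have := (integrable_mkcond (EFin \o g) mI).1 ig.
  by rewrite restrict_EFin.
have := FTC1Ny (f := g \_ I01).
move=> /(_ _ (integrable_locally_restrict mI ig)) H.
have iy (y : R) : leb.-integrable (`]-oo, y]%classic : set M) (EFin \o (g \_ I01)).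
  by apply: integrableS ig' => //; exact: measurable_ray.
have {}H := H iy.
have FF : Filter (nbhs (almost_everywhere leb)) := ae_filter_ringOfSetsType leb.
apply: filterS H => t /= [_ DF] tI.
have := DF; rewrite patchE mem_set; last first.
  by move: tI; rewrite /= !in_itv/= => /andP[t0 t1]; rewrite !ltW.
(* F is known only on [0,1]; an interior t has a neighbourhood there, and this fixes the
   derivative. *)
move=> <-; rewrite !derive1E; apply: near_eq_derive.
near=> s; rewrite FE; last first.
  rewrite in_itv/=; apply/andP; split; apply: ltW; near: s.
    by apply: lt_nbhsr; move: tI; rewrite in_itv/= => /andP[].
  by apply: lt_nbhsl; move: tI; rewrite in_itv/= => /andP[].
rewrite (ip_indic_unif mg (measurable_ray s)).
by rewrite -Rintegral_mkcondr setIC.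
Unshelve. all: by end_near. Qed.

Lemma copula_prod_ip (A B : R -> R -> R) (f g : M -> R) u v :
  sqint mu f -> sqint mu g ->
  (forall t, t \in `[0, 1] -> A u t = ip mu f (ray t)) ->
  (forall t, t \in `[0, 1] -> B t v = ip mu g (ray t)) ->
  copula_prod A B u v = ip mu f g.
Proof.
move=> Lf Lg Af Bg; have [mf _] := Lf; have [mg _] := Lg.
rewrite /ip Rintegral_unif; last exact: measurable_funM.
(* Measurability of the total function [derive1] is not established, hence the almost everywhere
   comparison that does not ask for it. *)
congr fine; apply: ae_eq_integral_null.
have FF : Filter (nbhs (almost_everywhere leb)) := ae_filter_ringOfSetsType leb.
(* The two endpoints, where the derivatives are not identified, form a null set. *)
have ne (a : R) : {ae leb, forall t, t != a}.
  exists [set a]; split; [exact: measurable_set1|exact: lebesgue_measure_set1|].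
  by move=> t /= /negP; rewrite negbK => /eqP.
apply: filterS3 (filterI (ne 0) (ne 1)) (ae_derive1_ip_ray Lf Af) (ae_derive1_ip_ray Lg Bg).
move=> t [t0 t1] ft gt; rewrite /= in_itv/= => /andP[t0' t1'].
have tI : t \in `]0, 1[ by rewrite in_itv/= !lt_neqAle eq_sym t0 t0' t1 t1'.
by rewrite ft// gt.
Qed.

(** C^n(u, .) has derivative T^n 1_[0,u] and C(., v) has derivative T 1_[0,v]; by symmetry the
    pairing of the two moves one more T onto the first factor. *)
Lemma copula_pow_ip n u v : (0 < n)%N -> u \in `[0, 1] -> v \in `[0, 1] ->
  copula_pow (series_copula lambda phi) n u v = ip mu (iter n T (ray u)) (ray v).
Proof.
case: n => // n _ uI vI; rewrite /copula_pow /=.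
elim: n v vI => [|n IH] v vI; first by rewrite -(series_copulaE (m := 1)).
have Ln := sqint_iter_kop k_sqint n.+1 (sqint_ray u).
rewrite /= (copula_prod_ip Ln (sqint_kop k_sqint (sqint_ray v)))//.
  by rewrite -(kop_sym e_on k_exp Ln (sqint_ray v)).
move=> t tI; rewrite [LHS](series_copulaE (m := 1))//=.
by rewrite (kop_sym e_on k_exp (sqint_ray t) (sqint_ray v)) ipC.
Qed.

End Copula.
(** * The Markov chain *)

(** Existential packaging leaves only the values on sets visible, which is all that the uniqueness
    results compare. *)
Lemma pushforward_measureE {d1 d2} {O : measurableType d1} {Y : measurableType d2}
    {R : realType} (m : {measure set O -> \bar R}) (x : O -> Y) :
  measurable_fun setT x ->
  exists m' : {measure set Y -> \bar R}, forall A, m' A = m (x @^-1` A).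
Proof.
move=> mx.
by exists (measure_function_pushforward__canonical__measure_function_Measure m mx).
Qed.

(** * Laws on the unit interval determined by rational rays *)

Section UnitRays.
Context {R : realType}.
Local Notation M := (measurableTypeR R).
Local Notation J := (`]0%R, 1%R]%classic : set M).

(** Moving an endpoint to the nearest point of [0,1] preserves the trace of the ray on the half-open
    [J]. On the closed interval it would not: for q < 0 the trace would gain the point 0. *)
Let clamp (q : rat) : rat := Num.max 0 (Num.min 1 q).

Let clampI q : (ratr (clamp q) : R) \in `[0, 1].
Proof.
by rewrite in_itv/= -[X in X <= _](@ratr_int R 0) -[X in _ && (_ <= X)](@ratr_int R 1)
  !ler_rat /clamp le_max lexx/= ge_max ler01/= ge_min lexx.
Qed.

Let setI_clamp (q : rat) : `]-oo, ratr q]%classic `&` J =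
  `]-oo, ratr (clamp q)]%classic `&` J.
Proof.
have E (x : R) : 0 < x -> x <= 1 -> (x <= ratr (clamp q)) = (x <= ratr q).
  move=> x0 x1; rewrite /clamp maxr_rat minr_rat rmorph0 rmorph1.
  by rewrite le_max le_min x1 (lt_geF x0).
by apply/seteqP; split=> x [] /=; rewrite !in_itv/= => xq /andP[x0 x1];
  split; rewrite ?x0 ?x1//; move: xq; rewrite E.
Qed.

(** A copula is specified only on [0,1]^2, so only rays with endpoint in [0,1] can be tested;
    vanishing off [J] settles the others. *)
Lemma eq_measure_unit_rays (m1 m2 : {measure set M -> \bar R}) :
  (m1 setT < +oo)%E -> (m1 (~` J) = 0)%E -> (m2 (~` J) = 0)%E ->
  (forall q : rat, (ratr q : R) \in `[0, 1] ->
    m1 `]-oo, ratr q]%classic = m2 `]-oo, ratr q]%classic) ->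
  forall A, measurable A -> m1 A = m2 A.
Proof.
move=> m1oo m1J m2J m12; apply: eq_measure_rat_rays => // q.
have mJ : measurable J by exact: measurable_itv.
have E (m : {measure set M -> \bar R}) (r : rat) : m (~` J) = 0%E ->
    m `]-oo, ratr r]%classic = m (`]-oo, ratr r]%classic `&` J).
  move=> mJ0; rewrite [LHS](measureDI _ _ mJ)// setDE.
  rewrite [X in (X + _)%E](_ : _ = 0%E) ?add0e//.
  apply: (subset_measure0 _ _ _ mJ0); [|exact: measurableC|exact: subIsetr].
  by apply: measurableI; [exact: measurable_itv|exact: measurableC].
by rewrite (E m1)// (E m2)// setI_clamp -(E m1)// -(E m2)// m12 ?clampI.
Qed.

Lemma unif_setC_J : unif R (~` J) = 0%E.
Proof.
have mJ : measurable J by exact: measurable_itv.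
have mI : measurable (`[0%R, 1%R]%classic : set M) by exact: measurable_itv.
rewrite -(setIT (~` J)) -integral_indic//; last exact: measurableC.
rewrite integral_unif; last first.
  by apply/measurable_EFinP; apply: measurable_indic; exact: measurableC.
rewrite integral_indic//; last exact: measurableC.
have -> : (~` J) `&` `[0%R, 1%R]%classic = [set 0%R]; last exact: lebesgue_measure_set1.
apply/seteqP; split=> x /=; rewrite !in_itv/=.
  move=> [/negP + /andP[x0 x1]]; rewrite x1 andbT -leNgt => x0'.
  by apply/eqP; rewrite eq_le x0 x0'.
by move=> ->; rewrite ltxx lexx ler01.
Qed.

End UnitRays.

Section Chain.
Context {R : realType}.
Local Notation leb := (@lebesgue_measure R).
Local Notation M := (measurableTypeR R).
Local Notation J := (`]0%R, 1%R]%classic : set M).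
Variables (lambda : nat -> R) (phi : nat -> R -> R) (c : R -> R -> R).
Hypothesis h_on : orthonormal_system (with_one phi).
Hypothesis h_c : L2_sum lambda phi c.
Hypothesis c0 : forall x y, x \in `[0, 1] -> y \in `[0, 1] -> 0 <= c x y.
Context {d} {O : measurableType d} (P : probability O R).
Variables (U : nat -> {RV P >-> R}) (kappa : R.-pker R ~> R).
Hypothesis hU : stationary_chain U (series_copula lambda phi) kappa.

Local Notation mu := (unif R).
Local Notation e := (restr_basis phi).
Local Notation lam := (with_one_coef lambda).
Local Notation k := (restr_kernel c).
Local Notation T := (kop mu k).
Local Notation ray u := (\1_(`]-oo, u]%classic) : M -> R).

Let e_on := orthonormal_restr_basis h_on.
Let k_exp := expansion_restr_kernel h_on h_c.
Let k_sqint := sqint_expansion e_on k_exp.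
Let k_ge0 := restr_kernel_ge0 c0.
Let FF : Filter (nbhs (almost_everywhere mu)).
Proof. exact: ae_filter_ringOfSetsType. Qed.
Let aeS (p q : M -> Prop) : (forall x, p x -> q x) ->
  {ae mu, forall x, p x} -> {ae mu, forall x, q x}.
Proof. exact: (@filterS _ _ FF). Qed.
Let mJ : measurable J. Proof. exact: measurable_itv. Qed.
Let indic_ge0 (A : set M) x : 0 <= (\1_A x : R). Proof. by rewrite indicE. Qed.

Let measurable_chain n : measurable_fun setT (U n : O -> M).
Proof. exact: (measurable_funPT (U n)). Qed.

Let measurable_chain_preimage n (A : set M) : measurable A ->
  measurable (U n @^-1` A).
Proof. by move=> mA; rewrite -[X in measurable X]setTI; exact: (measurable_chain n). Qed.

Let law n (A : set M) : measurable A -> P (U n @^-1` A) = mu A.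
Proof. by case: hU => H _ _; exact: H. Qed.

Let measurable_kappa (B : set M) : measurable B ->
  measurable_fun setT (fun x : M => kappa x B).
Proof. exact: (measurable_kernel kappa B). Qed.

Let kappa_le1 (B : set M) x : measurable B -> (kappa x B <= 1)%E.
Proof. move=> mB; have <- : kappa x setT = 1%E := prob_kernel x.
by apply: le_measure; rewrite ?inE. Qed.

Lemma integral_chain n (f : M -> \bar R) : measurable_fun setT f ->
  (forall x, 0 <= f x)%E -> (\int[P]_w f (U n w) = \int[mu]_x f x)%E.
Proof.
move=> mf f0.
transitivity (\int[P]_w (1%:E * f (U n w)))%E.
  by apply: eq_integral => w _; rewrite mul1e.
rewrite (change_of_density (P := P) (mu := mu) (w := cst 1) (h := cst 1))//.
  by apply: eq_integral => x _; rewrite mul1e.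
move=> A mA; under eq_integral do rewrite mul1e.
under [RHS]eq_integral do rewrite mul1e.
have -> : (\int[mu]_y (\1_A y)%:E = mu A)%E.
  by rewrite (integral_indic mu measurableT mA) setIT.
rewrite -(law n mA) -[RHS](congr1 P (setIT _)).
by rewrite -(integral_indic P measurableT (measurable_chain_preimage n mA)).
Qed.

Lemma integral_chain_in n (A : set M) (f : M -> \bar R) : measurable A ->
  measurable_fun setT f -> (forall x, 0 <= f x)%E ->
  (\int[P]_(w in U n @^-1` A) f (U n w) = \int[mu]_(x in A) f x)%E.
Proof.
move=> mA mf f0; rewrite integral_mkcond [RHS]integral_mkcond.
rewrite -(integral_chain n)//.
- exact: ((measurable_restrictT f mA).1 (measurable_funTS mf)).
- by move=> x; rewrite patchE; case: ifPn.
Qed.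

Let past_init n (A : set M) : measurable A -> past U n (U 0 @^-1` A).
Proof.
move=> mA; apply: sub_sigma_algebra; exists 0%N => //.
by exists A => //; rewrite setTI.
Qed.

Let markov n (A B : set M) : measurable A -> measurable B ->
  (P (U 0 @^-1` A `&` U n.+1 @^-1` B) = \int[P]_(w in U 0 @^-1` A) kappa (U n w) B)%E.
Proof. by case: hU => _ _ H mA mB; apply: H => //; exact: past_init. Qed.

Let markov1 (A B : set M) : measurable A -> measurable B ->
  (P (U 0 @^-1` A `&` U 1 @^-1` B) = \int[mu]_(x in A) kappa x B)%E.
Proof.
by move=> mA mB; rewrite markov// (integral_chain_in 0 mA (measurable_kappa mB)).
Qed.

Let integral_density (A : set M) (f : M -> R) : measurable A -> sqint mu f ->
  (\int[mu]_(x in A) (f x)%:E = (ip mu f \1_A)%:E)%E.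
Proof.
move=> mA Lf; rewrite (EFin_ip Lf (sqint_indic mu mA)) [LHS]integral_mkcond.
apply: eq_integral => x _; rewrite patchE indicE.
by case: (x \in A); rewrite ?mulr1 ?mulr0.
Qed.

Let iter_kop_indic_ge0 (A : set M) n x : 0 <= iter n T \1_A x.
Proof. exact: (kop_ge0 mu k_ge0 (indic_ge0 A)). Qed.

(** * Identification of the transition kernel *)

(** For a ray B, the measure A -> P(U_0 in A, U_1 in B) has density [kappa x B] by the Markov
    property and density T 1_B by the formula for C; two densities of one finite measure agree
    almost everywhere. *)
Lemma kappa_ray_ae (q : rat) : (ratr q : R) \in `[0, 1] ->
  {ae mu, forall x, kappa x `]-oo, ratr q]%classic = (T (ray (ratr q)) x)%:E}.
Proof.
move=> qI; set B : set M := `]-oo, ratr q]%classic.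
have mB : measurable B by exact: measurable_ray.
have LT : sqint mu (T \1_B) by apply: (sqint_kop k_sqint); exact: sqint_indic.
have [mT _] := LT.
have [m1 m1E] := pushforward_measureE
  (mrestr P (measurable_chain_preimage 1 mB)) (measurable_chain 0).
pose m2 : {measure set M -> \bar R} := density_measure mu mT (iter_kop_indic_ge0 B 1).
have m12 A : measurable A -> m1 A = m2 A.
  apply: eq_measure_unit_rays.
  - rewrite m1E /mrestr; apply: (@le_lt_trans _ _ 1%E); last exact: ltry.
    by apply: probability_le1; apply: measurableI; exact: measurable_chain_preimage.
  - rewrite m1E /mrestr; apply: (@subset_measure0 _ _ _ P _ (U 0 @^-1` (~` J))).
    + apply: measurableI; apply: measurable_chain_preimage => //.
      exact: measurableC.
    + by apply: measurable_chain_preimage; exact: measurableC.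
    + exact: subIsetl.
    + exact: (etrans (law 0 (measurableC mJ)) unif_setC_J).
  - apply: null_set_integral; [exact: measurableC| |exact: unif_setC_J].
    by apply: measurable_funTS; exact/measurable_EFinP.
  (* Here the joint distribution function of U_0 and U_1 enters. *)
  - move=> r rI; rewrite m1E /mrestr.
    transitivity ((series_copula lambda phi (ratr r) (ratr q))%:E).
      by case: hU => _ H _; rewrite -(H 0%N).
    rewrite -[LHS]/((series_copula (fun j => lambda j ^+ 1) _ _ _)%:E).
    rewrite (series_copulaE h_on h_c)// /m2 /= /density_measure.
    rewrite (integral_density (measurable_ray _) LT).
    by rewrite (kop_sym e_on k_exp (sqint_ray _) (sqint_ray _)) ipC.
have mk := measurable_kappa mB.
have ik : mu.-integrable setT (fun x => kappa x B).
  apply: le_integrable (sqint_integrable (sqint_cst mu 1)) => //.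
  by move=> x _ /=; rewrite gee0_abs// normr1; exact: kappa_le1.
have : ae_eq mu setT (fun x => kappa x B) (EFin \o T \1_B).
  apply: (integral_ae_eq measurableT ik); first exact/measurable_EFinP.
  by move=> A _ mA; rewrite -(markov1 mA mB) -[RHS]/(m2 A) -(m12 A mA) m1E.
by apply: filterS => x /(_ I).
Qed.

(** The mean of this nonnegative function is P(U_1 outside J) = 0. *)
Let kappa_J_ae : {ae mu, forall x, kappa x (~` J) = 0%E}.
Proof.
have mJc : measurable (~` J) by exact: measurableC.
have mk := measurable_kappa mJc.
have : (\int[mu]_x `|kappa x (~` J)| = 0)%E.
  under eq_integral do rewrite gee0_abs//.
  by rewrite -(markov1 measurableT mJc) preimage_setT setTI (law 1 mJc) unif_setC_J.
move/(ae_eq_integral_abs mu measurableT mk).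
by apply: aeS => x /(_ I).
Qed.

(** States from which one transition has density [k x]. The quantifier over A stands inside, so that
    a single null set serves all A. *)
Definition good_state (x : M) := sqint mu (k x) /\
  forall A, measurable A -> kappa x A = (ip mu (k x) \1_A)%:E.

(** Off the union of countably many null sets, the measures [kappa x] and k(x, y) dy agree on all
    rational rays in [0,1] and vanish off [J], hence coincide. *)
Lemma ae_good_state : {ae mu, forall x, good_state x}.
Proof.
have rays : {ae mu, forall x, forall q : rat, (ratr q : R) \in `[0, 1] ->
    kappa x `]-oo, ratr q]%classic = (T (ray (ratr q)) x)%:E}.
  (* The rationals are enumerated by [unpickle], since the countable intersection is indexed by
     naturals. *)
  have : {ae mu, forall x, forall n : nat,
      if unpickle n is Some q then (ratr (q : rat) : R) \in `[0, 1] ->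
        kappa x `]-oo, ratr q]%classic = (T (ray (ratr q)) x)%:E else True}.
    apply: ae_foralln => n; case: unpickle => [q|]; last exact: nearW.
    have [qI|qI] := boolP ((ratr q : R) \in `[0, 1]).
      by apply: aeS (kappa_ray_ae qI) => x H _.
    exact: nearW.
  apply: aeS => x H q; have := H (pickle q).
  by rewrite pickleK.
apply: (@filterS3 _ _ FF _ _ _ _ _ (ae_sqint_kernel_row k_sqint) kappa_J_ae rays) => x Lx xJ xr.
split => // A mA; have [mkx _] := Lx.
have [m1 m1E] := pushforward_measureE (kappa x) (x := fun y : R => y : M)
  (@measurable_id _ _ setT).
rewrite -(integral_density mA Lx).
transitivity (m1 A); first by rewrite m1E.
apply: (eq_measure_unit_rays (m2 := density_measure mu mkx (k_ge0 x))) mA.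
- rewrite m1E; apply: (@le_lt_trans _ _ 1%E); last exact: ltry.
  by rewrite preimage_setT; exact: kappa_le1.
- by rewrite m1E.
- apply: null_set_integral; [exact: measurableC| |exact: unif_setC_J].
  by apply: measurable_funTS; exact/measurable_EFinP.
- move=> q qI; rewrite m1E [LHS](xr q qI) /= /density_measure.
  by rewrite (integral_density (measurable_ray _) Lx).
Qed.

Lemma integral_kappa x (f : M -> \bar R) : good_state x -> measurable_fun setT f ->
  (forall y, 0 <= f y)%E ->
  (\int[kappa x]_y f y = \int[mu]_y ((k x y)%:E * f y))%E.
Proof.
move=> [Lx xE] mf f0; have [mkx _] := Lx.
transitivity (\int[kappa x]_y (1%:E * f y))%E.
  by apply: eq_integral => w _; rewrite mul1e.
apply: (change_of_density (x := fun y : R => y : M) (w := cst 1)) => // A mA.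
under eq_integral do rewrite mul1e.
rewrite (integral_indic (kappa x) measurableT mA) setIT xE//.
by rewrite (EFin_ip Lx (sqint_indic mu mA)); apply: eq_integral => y _; rewrite EFinM.
Qed.

(** * n-step transition probabilities and geometric ergodicity *)

Lemma nstep_measurable_ge0 n (A : set M) : measurable A ->
  measurable_fun (setT : set M) (fun x : M => nstep kappa n x A) /\
  forall x, (0 <= nstep kappa n x A)%E.
Proof.
move=> mA; elim: n => [|n [mn n0]] /=; first split=> [|x].
- rewrite (_ : (fun _ => _) = EFin \o \1_A); last by apply/funext => x; rewrite diracE.
  by apply/measurable_EFinP; exact: measurable_indic.
- by rewrite diracE lee_fin.
- split=> [|x]; last exact: integral_ge0.
  exact: (measurable_fun_integral_kernel (measurable_kernel kappa) n0 mn).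
Qed.

(** The null set in the hypothesis may depend on n and A. Integration against the density [k x]
    absorbs it, so the conclusion holds at every good state, for all n and A at once. *)
Let nstepS n x (A : set M) : measurable A -> good_state x ->
  {ae mu, forall y, nstep kappa n y A = (iter n T \1_A y)%:E} ->
  nstep kappa n.+1 x A = (ip mu (k x) (iter n T \1_A))%:E.
Proof.
move=> mA xG nE; have [mn n0] := nstep_measurable_ge0 n mA.
have LA := sqint_iter_kop k_sqint n (sqint_indic mu mA).
have [[mkx _] _] := xG; have [mi _] := LA.
rewrite /= (integral_kappa xG mn n0) (EFin_ip xG.1 LA).
apply: ae_eq_integral => //.
- by apply: emeasurable_funM => //; exact/measurable_EFinP.
- by apply/measurable_EFinP; exact: measurable_funM.
- by apply: aeS nE => y -> _; rewrite EFinM.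
Qed.

Lemma nstep_ae n (A : set M) : measurable A ->
  {ae mu, forall y, nstep kappa n y A = (iter n T \1_A y)%:E}.
Proof.
move=> mA; elim: n => [|n IH]; first by apply: nearW => y; rewrite /= diracE.
by apply: aeS ae_good_state => x xG; rewrite (nstepS mA xG IH).
Qed.

Lemma nstepE n x (A : set M) : measurable A -> good_state x ->
  nstep kappa n.+1 x A = (ip mu (k x) (iter n T \1_A))%:E.
Proof. by move=> mA xG; apply: nstepS => //; exact: nstep_ae. Qed.

Let dist_le1 (a b : \bar R) : (0 <= a <= 1)%E -> (0 <= b <= 1)%E -> (`|a - b| <= 1)%E.
Proof.
move: a b => [a| |] [b| |]; rewrite ?lee_fin ?leye_eq ?leNye ?andbF//.
move=> /andP[a0 a1] /andP[b0 b1].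
by rewrite ler_norml; apply/andP; split; lra.
Qed.

Lemma geometrically_ergodic_chain (s : R) : 0 <= s < 1 ->
  (forall j, `|lambda j| <= s) -> geometrically_ergodic kappa mu.
Proof.
(* The rate lies strictly above 0 even if s = 0, since the constant below divides by it. *)
move=> /andP[s0 s1] lams; pose r := (1 + s) / 2.
have r0 : 0 < r by rewrite /r; lra.
have r1 : r < 1 by rewrite /r; lra.
have sr : s <= r by rewrite /r; lra.
exists r; split; [exact: ltW|by []|].
apply: aeS ae_good_state => x xG; have [Lx xE] := xG.
(* The fraction is the constant of [iter_kop_dist] for c(x, .) and an indicator of norm at most 1;
   the extra 1 makes K at least 1, which covers n = 0 and n = 1 by the trivial bound on total
   variation. *)
pose K := 1 + (ip mu (k x) (k x) + 1) / 2.
have K1 : 1 <= K by have := ip_ge0 mu (k x); rewrite /K; lra.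
(* The division by r compensates for the one transition used up by c(x, .): n steps contract only by
   s^(n-1). *)
exists (K / r) => n; apply: ge_ereal_sup => _ [A mA <-].
have muA : (0 <= mu A <= 1)%E by rewrite measure_ge0 probability_le1.
have Kle m (a : R) : (m <= 1)%N -> a <= 1 -> a <= K / r * r ^+ m.
  move=> m1 a1; apply: (le_trans a1); apply: (le_trans K1).
  rewrite -mulrA ler_peMr ?(le_trans _ K1)//.
  by case: m m1 => [|[|]]// _; rewrite ?expr0 ?expr1 ?mulr1 ?mulVf ?gt_eqF// ltW// invf_gt1.
have Mle m (a : \bar R) : (m <= 1)%N -> (a <= 1)%E -> (a <= (K / r * r ^+ m)%:E)%E.
  by move=> m1 /le_trans; apply; rewrite lee_fin; exact: Kle.
case: n => [|[|m]].
- apply: Mle => //; apply: dist_le1 => //.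
  by rewrite /= diracE !lee_fin; case: (_ \in _); rewrite ?lexx ?ler01.
- apply: Mle => //; apply: dist_le1 => //.
  by rewrite (nstepE 0 mA xG) -(xE A mA) measure_ge0 kappa_le1.
- rewrite (nstepE m.+1 mA xG) -(EFin_ip_indic_restr_basis0 h_on mA) -EFinB lee_fin.
  have LA := sqint_indic mu mA.
  have x1 : ip mu (k x) (e 0) = 1.
    rewrite -(ip_one h_on Lx) ipC; apply: EFin_inj.
    have kT : kappa x setT = 1%E := prob_kernel (x : R).
    by rewrite -indicT; exact: (etrans (esym (xE setT measurableT)) kT).
  have AA : ip mu \1_A \1_A <= 1.
    rewrite -lee_fin -(integral_density mA LA) (integral_indic mu mA mA) setIid.
    by case/andP: muA.
  (* Moving the iterates onto c(x, .) makes the bound uniform in A. *)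
  rewrite -(iter_kop_sym e_on k_exp m.+1 Lx LA).
  have := @iter_kop_dist _ _ _ mu e lam k e_on k_exp _ _ m.+1 (s ^+ m.+1) Lx LA.
  rewrite x1 mul1r => /(_ isT erefl) H; apply: (le_trans (H _)).
    by move=> j; apply: lerXn2r (lams j); rewrite nnegrE.
  rewrite [r ^+ m.+2]exprS [leRHS]mulrA divfK ?gt_eqF// [leRHS]mulrC.
  rewrite ler_pM ?exprn_ge0//.
  + by rewrite divr_ge0// addr_ge0// ip_ge0.
  + by apply: lerXn2r sr; rewrite nnegrE// ltW.
  + apply: (@le_trans _ _ ((ip mu (k x) (k x) + 1) / 2)).
      by rewrite ler_pM2r ?invr_gt0// lerD2l.
    by rewrite /K lerDr.
Qed.

(** * Joint laws, correlations and rho_n *)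

Let integral_indic2 n (A B : set M) : measurable A -> measurable B ->
  (\int[P]_w ((\1_A (U 0 w))%:E * (\1_B (U n w))%:E) =
   P (U 0 @^-1` A `&` U n @^-1` B))%E.
Proof.
move=> mA mB.
have mAB : measurable (U 0 @^-1` A `&` U n @^-1` B).
  by apply: measurableI; exact: measurable_chain_preimage.
transitivity (\int[P]_w (\1_(U 0 @^-1` A `&` U n @^-1` B) w)%:E)%E.
  by apply: eq_integral => w _; rewrite indicI EFinM.
by rewrite (integral_indic P measurableT mAB) setIT.
Qed.

Let measurable_comp_chain n (f : M -> R) : measurable_fun setT f ->
  measurable_fun setT (fun w => f (U n w)).
Proof. by move=> mf; exact: (measurableT_comp mf (measurable_chain n)). Qed.

(** By induction T^n 1_A is the conditional expectation of 1_A(U_0) given U_n. One more step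
    integrates it against [kappa y B], almost everywhere T 1_B, and symmetry moves this T to the
    other side. *)
Lemma joint_law n (A B : set M) : measurable A -> measurable B ->
  P (U 0 @^-1` A `&` U n @^-1` B) = (ip mu (iter n T \1_A) \1_B)%:E.
Proof.
move=> mA; have LA := sqint_indic mu mA; elim: n B => [|n IH] B mB.
  rewrite /= -(integral_density mB LA) (integral_indic mu mB mA).
  exact: (law 0 (measurableI _ _ mA mB)).
have Ln := sqint_iter_kop k_sqint n LA; have [mn _] := Ln.
have LB := sqint_indic mu mB; have LTB := sqint_kop k_sqint LB.
have [mTB _] := LTB; have mk := measurable_kappa mB.
rewrite /= (kop_sym e_on k_exp Ln LB) (EFin_ip Ln LTB) markov//.
transitivity (\int[P]_w ((\1_A (U 0 w))%:E * kappa (U n w) B))%E.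
  rewrite integral_mkcond; apply: eq_integral => w _; rewrite patchE indicE.
  rewrite (_ : (w \in U 0 @^-1` A) = (U 0 w \in A)); last by apply/idP/idP => /set_mem H; apply/mem_set.
  by case: (_ \in _); rewrite ?mul1e ?mul0e.
transitivity (\int[mu]_y ((iter n T \1_A y)%:E * kappa y B))%E.
  apply: (@change_of_density _ _ O M R P mu (fun w => \1_A (U 0 w)) (U n)
    (iter n T \1_A) _ _ _ _ _ _ (fun y => kappa y B)) => //.
  - by apply: measurable_comp_chain; exact: measurable_indic.
  - move=> D mD; rewrite integral_indic2// IH// (EFin_ip Ln (sqint_indic mu mD)).
    by apply: eq_integral => y _; rewrite EFinM.
apply: ae_eq_integral => //.
- by apply: emeasurable_funM => //; exact/measurable_EFinP.
- by apply/measurable_EFinP; exact: measurable_funM.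
- apply: aeS ae_good_state => x [Lx xE] _.
  by rewrite EFinM xE.
Qed.

(** Indicators are replaced one variable at a time: f is reached with weight 1_B(U_n), then g with
    weight f(U_0). *)
Lemma correlation_ge0 n (f g : M -> R) : sqint mu f -> sqint mu g ->
  (forall x, 0 <= f x) -> (forall x, 0 <= g x) ->
  (\int[P]_w (f (U 0 w) * g (U n w))%:E = (ip mu (iter n T f) g)%:E)%E.
Proof.
move=> Lf Lg f0 g0; have [mf _] := Lf; have [mg _] := Lg.
have Lnf := sqint_iter_kop k_sqint n Lf; have [mnf _] := Lnf.
have half (B : set M) : measurable B ->
    (\int[P]_w ((f (U 0 w))%:E * (\1_B (U n w))%:E) =
     (ip mu (iter n T f) \1_B)%:E)%E.
  move=> mB; have LB := sqint_indic mu mB.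
  have LnB := sqint_iter_kop k_sqint n LB; have [mnB _] := LnB.
  transitivity (\int[P]_w ((\1_B (U n w))%:E * (f (U 0 w))%:E))%E.
    by apply: eq_integral => w _; rewrite muleC.
  rewrite (iter_kop_sym e_on k_exp n Lf LB) ipC (EFin_ip LnB Lf).
  apply: (@change_of_density _ _ O M R P mu (fun w => \1_B (U n w)) (U 0)
    (iter n T \1_B) _ _ _ _ _ _ (EFin \o f)) => //.
  - by apply: measurable_comp_chain; exact: measurable_indic.
  - move=> A mA; have LA := sqint_indic mu mA.
    transitivity (\int[P]_w ((\1_A (U 0 w))%:E * (\1_B (U n w))%:E))%E.
      by apply: eq_integral => w _; rewrite muleC.
    rewrite integral_indic2// joint_law//.
    rewrite (iter_kop_sym e_on k_exp n LA LB) ipC (EFin_ip LnB LA).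
    by apply: eq_integral => x _; rewrite EFinM.
  - exact/measurable_EFinP.
transitivity (\int[P]_w ((f (U 0 w))%:E * (g (U n w))%:E))%E.
  by apply: eq_integral => w _; rewrite EFinM.
rewrite (EFin_ip Lnf Lg).
apply: (@change_of_density _ _ O M R P mu (fun w => f (U 0 w)) (U n)
  (iter n T f) _ _ _ _ _ _ (EFin \o g)) => //.
- exact: measurable_comp_chain.
- exact: kop_ge0.
- move=> A mA; rewrite half// (EFin_ip Lnf (sqint_indic mu mA)).
  by apply: eq_integral => x _; rewrite EFinM.
- exact/measurable_EFinP.
Qed.

(** Splitting f into positive and negative parts gives four nonnegative products; their integrals
    are finite by [correlation_ge0], which justifies the subtraction. *)
Lemma correlation n (f : M -> R) : sqint mu f ->
  (\int[P]_w (f (U 0 w) * f (U n w))%:E = (ip mu (iter n T f) f)%:E)%E.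
Proof.
move=> Lf; have [mf _] := Lf.
have La : sqint mu (fun x => `|f x|).
  by apply: (le_sqint _ Lf) => [|x]; [exact: measurableT_comp|rewrite normr_id].
pose p x := 2^-1 * (`|f x| + f x); pose q x := 2^-1 * (`|f x| - f x).
have Lp : sqint mu p by apply: sqintZ; exact: sqintD.
have Lq : sqint mu q by apply: sqintZ; exact: sqintB.
have p0 x : 0 <= p x by have := ler_norm (- f x); rewrite normrN /p; lra.
have q0 x : 0 <= q x by have := ler_norm (f x); rewrite /q; lra.
have fE : f = (fun x => p x - q x) by apply/funext => x; rewrite /p /q; field.
have int (g h : M -> R) : sqint mu g -> sqint mu h -> (forall x, 0 <= g x) ->
    (forall x, 0 <= h x) ->
    P.-integrable setT (EFin \o (fun w => g (U 0 w) * h (U n w))).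
  move=> Lg Lh g0 h0; apply/integrableP; split.
    apply/measurable_EFinP; apply: measurable_funM.
      by apply: measurable_comp_chain; case: Lg.
    by apply: measurable_comp_chain; case: Lh.
  under eq_integral do rewrite /= ger0_norm ?mulr_ge0//.
  by rewrite correlation_ge0// ltry.
have Lpp := int p p Lp Lp p0 p0; have Lqq := int q q Lq Lq q0 q0.
have Lpq := int p q Lp Lq p0 q0; have Lqp := int q p Lq Lp q0 p0.
transitivity (\int[P]_w ((p (U 0 w) * p (U n w) + q (U 0 w) * q (U n w))%:E -
    (p (U 0 w) * q (U n w) + q (U 0 w) * p (U n w))%:E))%E.
  by apply: eq_integral => w _; rewrite -EFinB {1 2}fE; congr EFin; ring.
rewrite integralB_EFin//; last 2 first.
- exact: (integrableD measurableT Lpp Lqq).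
- exact: (integrableD measurableT Lpq Lqp).
rewrite (integralD_EFin measurableT Lpp Lqq) (integralD_EFin measurableT Lpq Lqp).
rewrite !correlation_ge0// -!EFinD; congr EFin.
have Lnp := sqint_iter_kop k_sqint n Lp; have Lnq := sqint_iter_kop k_sqint n Lq.
have E g : sqint mu g -> ip mu (iter n T f) g = ip mu (iter n T p) g - ip mu (iter n T q) g.
  move=> Lg; have Lng := sqint_iter_kop k_sqint n Lg.
  rewrite (iter_kop_sym e_on k_exp n Lf Lg) (iter_kop_sym e_on k_exp n Lp Lg).
  by rewrite (iter_kop_sym e_on k_exp n Lq Lg) -(ipBl Lp Lq Lng) -fE.
have := ipBl Lp Lq (sqint_iter_kop k_sqint n Lf); rewrite -fE.
by rewrite !(ipC _ _ (iter n T f)) => ->; rewrite (E _ Lp) (E _ Lq); ring.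
Qed.

Lemma integral_chain_EFin n (f : M -> R) : measurable_fun setT f ->
  (\int[P]_w (f (U n w))%:E = \int[mu]_x (f x)%:E)%E.
Proof.
move=> mf; have mEf : measurable_fun setT (EFin \o f) by exact/measurable_EFinP.
rewrite integralE [RHS]integralE; congr (_ - _)%E.
- rewrite -(integral_chain n (measurable_funepos mEf)); last by move=> x; exact: funepos_ge0.
  by apply: eq_integral => w _; rewrite !funeposE.
- rewrite -(integral_chain n (measurable_funeneg mEf)); last by move=> x; exact: funeneg_ge0.
  by apply: eq_integral => w _; rewrite !funenegE.
Qed.

Lemma rho_chain n : (1 <= n)%N ->
  rho U n = ereal_sup (range (fun j => (`|lambda j| ^+ n)%:E)).
Proof.
move=> n0; apply/eqP; rewrite eq_le; apply/andP; split.
- apply: ge_ereal_sup => _ [f [mf f0 f2 ->]].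
  have f2mu : (\int[mu]_x (f x ^+ 2)%:E = 1)%E.
    rewrite -f2; apply/esym.
    by apply: (integral_chain_EFin 0 (f := fun x => f x ^+ 2)); exact: measurable_funX.
  have Lf : sqint mu f.
    split => //; apply/integrableP; split.
      by apply/measurable_EFinP; exact: measurable_funX.
    under eq_integral do rewrite /= ger0_norm ?sqr_ge0//.
    by rewrite f2mu ltry.
  have ff : ip mu f f = 1.
    by rewrite /ip /Rintegral; under eq_integral do rewrite -expr2; rewrite f2mu.
  have fe : ip mu f (e 0) = 0.
    rewrite (ip_restr_basis0 h_on mf) /Rintegral.
    by rewrite -[X in fine X](integral_chain_EFin 0 mf) f0.
  rewrite (correlation n Lf).
  set S := ereal_sup _.
  have lamS j : ((`|lambda j| ^+ n)%:E <= S)%E by apply: ereal_sup_ubound; exists j.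
  have S0 : (0 <= S)%E by apply: le_trans (lamS 0%N); rewrite lee_fin exprn_ge0.
  (* Only a finite supremum needs the spectral bound. *)
  case: S lamS S0 => [s| |] lamS _; [|by rewrite leey|by have := lamS 0%N].
  have := @iter_kop_dist _ _ _ mu e lam k e_on k_exp _ _ n s Lf Lf n0 erefl.
  rewrite fe mul0r subr0 ff lee_fin => /(_ (fun j => _)) H.
  apply: le_trans (H _) _; first by move=> j; have := lamS j; rewrite lee_fin.
  by rewrite -[_ / 2]/((1 + 1) / 2) -mulr2n mulfV ?mulr1.
- apply: ge_ereal_sup => _ [j _ <-]; apply: ereal_sup_ubound.
  have me := measurable_restr_basis h_on j.+1.
  (* An eigenfunction realises |lambda_j|^n; orthogonality to the constant gives it mean zero. *)
  exists (e j.+1); split => //.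
  + rewrite (integral_chain_EFin 0 me).
    rewrite -[RHS](EFin_integral_restr_basis h_on j.+1 0).
    apply: eq_integral => x _; rewrite /e !patchE; case: ifPn => _ /=.
      by rewrite mulr1.
    by rewrite mul0r.
  + rewrite (integral_chain_EFin 0 (f := fun x => e j.+1 x ^+ 2)); last exact: measurable_funX.
    rewrite -[RHS]/((true : nat)%:R%:E) -[in RHS](eqxx j.+1).
    rewrite -(EFin_integral_restr_basis h_on j.+1 j.+1).
    by apply: eq_integral => x _; rewrite expr2.
  + have [Le oe] := e_on; rewrite (correlation n (Le j.+1)).
    by rewrite (iter_kop_eigen e_on k_exp j.+1 n (Le j.+1)) oe eqxx mulr1 -normrX.
Qed.

(** * Finite spectrum and psi-mixing *)

Definition truncated (L : nat) (f : M -> R) : M -> R :=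
  fun x => f x * \1_[set y | `|f y| <= L%:R] x.

Let measurable_truncated L f : measurable_fun setT f ->
  measurable_fun setT (truncated L f).
Proof.
move=> mf; apply: measurable_funM => //; apply: measurable_indic.
have := @measurable_fun_le _ M R setT (fun y => `|f y|) (cst L%:R) measurableT.
by rewrite setTI; apply => //; exact: measurableT_comp.
Qed.

Let truncated_le L f x : `|truncated L f x| <= `|f x|.
Proof.
rewrite /truncated indicE; case: (_ \in _); first by rewrite mulr1.
by rewrite mulr0 normr0.
Qed.

Let truncated_bounded L f x : `|truncated L f x| <= L%:R.
Proof.
rewrite /truncated indicE; case: (boolP (_ \in _)) => [/set_mem|_] /=.
  by rewrite mulr1.
by rewrite mulr0 normr0.
Qed.

Let sqint_truncated L f : sqint mu f -> sqint mu (truncated L f).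
Proof.
move=> Lf; apply: (le_sqint _ Lf) => [|x]; last exact: truncated_le.
by apply: measurable_truncated; case: Lf.
Qed.

(** At each point the truncation eventually equals g, and |f g| dominates. *)
Lemma cvg_ip_truncated f g : sqint mu f -> sqint mu g ->
  ip mu f (truncated L g) @[L --> \oo] --> ip mu f g.
Proof.
move=> Lf Lg; have ifg := sqintM Lf Lg.
have [mf _] := Lf; have [mg _] := Lg.
have [] := @dominated_convergence _ _ _ mu setT measurableT
  (fun L x => (f x * truncated L g x)%:E) (fun x => (f x * g x)%:E)
  (fun x => `|(f x * g x)%:E|%E).
- move=> L; apply/measurable_EFinP; apply: measurable_funM => //.
  exact: measurable_truncated.
- by apply/measurable_EFinP; exact: measurable_funM.
- apply: (@nearW _ _ _ FF) => x _; apply: cvg_near_cst.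
  exists (Num.truncn `|g x|).+1 => // L /= gL.
  rewrite /truncated indicE mem_set ?mulr1//=.
  by apply: (le_trans (ltW (truncnS_gt _))); rewrite ler_nat.
- exact: integrable_abse.
- apply: (@nearW _ _ _ FF) => x L _; rewrite lee_fin normrM [leRHS]normrM.
  by apply: ler_wpM2l => //; exact: truncated_le.
move=> _ _; rewrite -(EFin_ip Lf Lg) => /fine_cvgP[_].
by [].
Qed.

Section FiniteSpectrum.
Variable N : nat.
Hypothesis lambda0 : forall j, (N <= j)%N -> lambda j = 0.

Lemma ip_iter_kop_finite m f g : sqint mu f -> sqint mu g -> (0 < m)%N ->
  ip mu (iter m T f) g = ip mu f (e 0) * ip mu g (e 0) +
    \sum_(i < N) lambda i ^+ m * ip mu f (e i.+1) * ip mu g (e i.+1).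
Proof.
move=> Lf Lg m0; apply: cvg_unique (cvg_ip_iter_kop e_on k_exp Lf Lg m0) _ => //.
apply: cvg_near_cst; exists N.+1 => // -[//|n] /= Nn.
rewrite big_ord_recl /= expr1n mul1r; congr (_ + _).
pose F i := lambda i ^+ m * ip mu f (e i.+1) * ip mu g (e i.+1).
rewrite -[LHS](big_mkord xpredT F) -[RHS](big_mkord xpredT F).
rewrite (big_cat_nat (n := N))//= [X in _ + X]big_nat [X in _ + X]big1 ?addr0//.
by move=> i /andP[Ni _]; rewrite /F lambda0// expr0n eqn0Ngt m0 !mul0r.
Qed.

(* Testing the positive function [T \1_A] against bounded truncations of the
   eigenfunctions replaces the essential boundedness of these eigenfunctions. *)
Lemma coef_bound : exists2 K : R, 0 <= K &
  forall A j, measurable A -> (j < N)%N ->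
    `|lambda j * ip mu \1_A (e j.+1)| <= K * ip mu \1_A (e 0).
Proof.
have [Le oe] := e_on.
(* Chosen so that N eta <= 1/2: the errors proportional to B then sum to at most B / 2 and are
   absorbed. *)
pose eta : R := (2 * (N.+1)%:R)^-1.
have eta0 : 0 < eta by rewrite invr_gt0 mulr_gt0// ltr0n.
have [L HL] : exists L : nat, forall i : 'I_N.+1, forall j : 'I_N,
    `|ip mu (e i) (truncated L (e j.+1)) - (i == j.+1 :> nat)%:R| <= eta.
  have : \forall L \near \oo, forall i : 'I_N.+1, forall j : 'I_N,
      `|ip mu (e i) (truncated L (e j.+1)) - (i == j.+1 :> nat)%:R| <= eta.
    apply: filter_forall => i; apply: filter_forall => j.
    have /cvgrPdist_le/(_ _ eta0) := cvg_ip_truncated (Le i) (Le j.+1).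
    by rewrite oe; apply: filterS => L; rewrite distrC.
  by case=> L0 _ /(_ L0 (leqnn _)); exists L0.
(* Obtained from B <= N (L a + a eta) + B / 2 with eta <= 1. *)
exists (2 * N%:R * (L%:R + 1)); first by rewrite !mulr_ge0// addr_ge0.
move=> A j0 mA j0N; have LA := sqint_indic mu mA.
have LTA := sqint_kop k_sqint LA; have L1 := sqint_cst mu 1.
pose a := ip mu \1_A (e 0).
have a0 : 0 <= a by rewrite -lee_fin /a EFin_ip_indic_restr_basis0// measure_ge0.
pose b i := lambda i * ip mu \1_A (e i.+1).
have T1 : ip mu (T \1_A) (cst 1) = a.
  by rewrite ipC (ip_one h_on LTA) (kop_eigen e_on k_exp 0 LA) mul1r.
(* T 1_A is nonnegative with total mass a, and the truncation lies between -L and L. *)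
have TA (j : 'I_N) : `|ip mu (T \1_A) (truncated L (e j.+1))| <= L%:R * a.
  set t := truncated L (e j.+1); have Lt : sqint mu t by exact: sqint_truncated.
  have LL : sqint mu (cst L%:R) by exact: sqint_cst.
  have TL : ip mu (T \1_A) (cst L%:R) = L%:R * a.
    rewrite -T1 ipC [ip mu (T _) _ in RHS]ipC -(ipZl _ L1 LTA).
    by congr ip; apply/funext => x; rewrite /= mulr1.
  have tb x : `|t x| <= L%:R := truncated_bounded L (e j.+1) x.
  have P1 : 0 <= ip mu (fun x => cst L%:R x - t x) (T \1_A).
    apply: Rintegral_ge0 => x _; rewrite mulr_ge0 ?(iter_kop_indic_ge0 A 1)//.
    by rewrite subr_ge0 (le_trans (ler_norm _)).
  have P2 : 0 <= ip mu (fun x => cst L%:R x + t x) (T \1_A).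
    apply: Rintegral_ge0 => x _; rewrite mulr_ge0 ?(iter_kop_indic_ge0 A 1)//.
    by rewrite /=; have := tb x; rewrite ler_norml => /andP[H _]; lra.
  move: P1 P2; rewrite (ipBl LL Lt LTA) (ipDl LL Lt LTA) !(ipC _ _ (T \1_A)) TL.
  by rewrite ler_norml => P1 P2; apply/andP; split; lra.
have E (j : 'I_N) : ip mu (T \1_A) (truncated L (e j.+1)) =
    a * ip mu (e 0) (truncated L (e j.+1)) +
    \sum_(i < N) b i * ip mu (e i.+1) (truncated L (e j.+1)).
  rewrite (ip_iter_kop_finite (m := 1) LA (sqint_truncated L (Le j.+1)))//.
  rewrite (ipC _ (truncated _ _)); congr (_ + _); apply: eq_bigr => i _.
  by rewrite expr1 (ipC _ (truncated _ _)).
pose B := \sum_(i < N) `|b i|.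
have B0 : 0 <= B by exact: sumr_ge0.
(* The matrix of pairings of the e_(i+1) with the truncated e_(j+1) is within eta of the identity,
   so b_j is the pairing with T 1_A up to small errors. *)
have bj (j : 'I_N) : `|b j| <= L%:R * a + a * eta + B * eta.
  have -> : b j = ip mu (T \1_A) (truncated L (e j.+1))
      - a * (ip mu (e 0) (truncated L (e j.+1)) - 0)
      - \sum_(i < N) b i * (ip mu (e i.+1) (truncated L (e j.+1)) - (i == j)%:R).
    have D : \sum_(i < N) b i * (i == j)%:R = b j.
      rewrite (bigD1 j)//= eqxx mulr1 big1 ?addr0// => i /negbTE ->.
      by rewrite mulr0.
    rewrite E subr0; under [X in _ - X]eq_bigr do rewrite mulrBr.
    by rewrite sumrB D; ring.
  apply: le_trans (ler_normB _ _) _; apply: lerD.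
    apply: le_trans (ler_normB _ _) _; apply: lerD => //.
    rewrite normrM ger0_norm// ler_wpM2l//.
    exact: (HL ord0 j).
  apply: le_trans (ler_norm_sum _ _ _) _; rewrite mulr_suml; apply: ler_sum => i _.
  rewrite normrM ler_wpM2l//.
  by have := HL (lift ord0 i) j; rewrite lift0 eqSS.
have BN : B <= N%:R * (L%:R * a + a * eta + B * eta).
  rewrite mulr_natl -[in leRHS](card_ord N) -sumr_const.
  by apply: ler_sum => j _; exact: bj.
have Neta : N%:R * eta <= 2^-1.
  rewrite /eta invfM mulrCA ler_piMr ?invr_ge0// ler_pdivrMr ?ltr0n// mul1r.
  by rewrite ler_nat.
have N0 : 0 <= (N%:R : R) by [].
have eta1 : eta <= 1.
  rewrite /eta invf_le1 ?mulr_gt0 ?ltr0n//.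
  by rewrite -natrM ler1n.
apply: (@le_trans _ _ B).
  by rewrite /B (bigD1 (Ordinal j0N))//= lerDl sumr_ge0.
have : N%:R * (B * eta) <= B / 2.
  by rewrite mulrCA ler_wpM2l.
have : N%:R * (a * eta) <= N%:R * a by rewrite ler_wpM2l// ler_piMr.
by move: BN; rewrite !mulrDr -/a; nra.
Qed.

End FiniteSpectrum.

Lemma psi_mixing_chain : finite_set [set j | lambda j != 0] ->
  (forall j, `|lambda j| < 1) -> psi_mixing U.
Proof.
move=> fin lam1.
have [N HN] : exists N, forall j, (N <= j)%N -> lambda j = 0.
  have [r rE] := (finite_seqP _).1 fin.
  exists (\max_(i <- r) i).+1 => j rj; apply: contraTeq rj => lj.
  rewrite -leqNgt; have jr : j \in r.
    have : [set` r] j by rewrite -rE.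
    by [].
  exact: leq_bigmax_seq.
have [K K0 HK] := coef_bound HN.
(* Of the n factors lambda_i, two are spent on the coefficient bounds for A and B, each of which
   costs a factor K. *)
pose eps n : R := K ^+ 2 * \sum_(i < N) `|lambda i| ^+ (n - 2).
have eps_cvg : eps n @[n --> \oo] --> 0.
  have pow0 m : \sum_(i < m) `|lambda i| ^+ n @[n --> \oo] --> 0.
    elim: m => [|m IH]; first by under eq_fun do rewrite big_ord0; exact: cvg_cst.
    under eq_fun do rewrite big_ord_recr.
    have : \sum_(i < m) `|lambda i| ^+ n + `|lambda m| ^+ n @[n --> \oo] --> (0 + 0 : R).
      by apply: cvgD => //; apply: cvg_expr; rewrite normr_id.
    by rewrite addr0.
  rewrite -(cvg_shiftn 2) /eps; under eq_fun do under eq_bigr do rewrite addnK.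
  have : K ^+ 2 * \sum_(i < N) `|lambda i| ^+ n @[n --> \oo] --> K ^+ 2 * 0.
    by apply: cvgM; [exact: cvg_cst|exact: pow0].
  by rewrite mulr0.
apply: (@squeeze_cvge _ _ _ _ (cst 0%E) _ (EFin \o eps)); last 2 first.
- exact: cvg_cst.
- by apply: cvg_EFin => //; exact: nearW.
exists 2 => // n /= n2; apply/andP; split.
  (* The whole space, as A and as B, contributes the value 0, so the supremum is nonnegative. *)
  apply: le_ereal_sup_tmp; eexists.
    exists setT, setT; split; [exact: measurableT|exact: measurableT| |reflexivity].
    by rewrite preimage_setT probability_setT mule1 lte01.
  by rewrite !preimage_setT setIT probability_setT mule1 subee// abse0 mul0e.
apply: ge_ereal_sup => r [A [B [mA mB + ->]]].
have LA := sqint_indic mu mA; have LB := sqint_indic mu mB.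
have PE (D : set M) : measurable D -> P (U 0 @^-1` D) = (ip mu \1_D (e 0))%:E.
  by move=> mD; exact: (etrans (law 0 mD) (esym (EFin_ip_indic_restr_basis0 h_on mD))).
have -> : P (U 0 @^-1` A) = (ip mu \1_A (e 0))%:E := PE A mA.
have -> : P (U 0 @^-1` B) = (ip mu \1_B (e 0))%:E := PE B mB.
have -> : P (U 0 @^-1` A `&` U n @^-1` B) = (ip mu (iter n T \1_A) \1_B)%:E :=
  joint_law n mA mB.
rewrite (ip_iter_kop_finite HN LA LB) ?(leq_trans _ n2)//.
set a := ip mu \1_A (e 0); set b := ip mu \1_B (e 0).
rewrite -!EFinM lte_fin => ab0.
rewrite -EFinB addrC addKr abse_EFin inver gt_eqF// -EFinM lee_fin ler_pdivrMr//.
apply: le_trans (ler_norm_sum _ _ _) _.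
rewrite /eps mulr_sumr mulr_suml; apply: ler_sum => i _.
rewrite -{1}(subnK n2) exprD.
rewrite (_ : _ * _ * _ = lambda i ^+ (n - 2) *
  ((lambda i * ip mu \1_A (e i.+1)) * (lambda i * ip mu \1_B (e i.+1)))); last by ring.
rewrite normrM normrX [leRHS]mulrAC [leRHS]mulrC ler_wpM2l ?exprn_ge0// normrM.
rewrite (_ : K ^+ 2 * _ = (K * a) * (K * b)); last by ring.
by apply: ler_pM => //; apply: HK.
Qed.

End Chain.

(** * Exponential rates and the equivalence *)

(** If x > r, then K (r/x)^n tends to 0 while remaining at least 1. *)
Lemma le_of_exp_bound {R : realType} (x r K : R) : 0 <= r ->
  (forall n, (1 <= n)%N -> x ^+ n <= K * r ^+ n) -> x <= r.
Proof.
move=> r0 H; rewrite leNgt; apply/negP => rx.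
have x0 : 0 < x by exact: le_lt_trans rx.
have q0 : 0 <= r / x by apply: divr_ge0 => //; exact: ltW.
have q1 : `|r / x| < 1 by rewrite (ger0_norm q0) ltr_pdivrMr// mul1r.
have : K * (r / x) ^+ n @[n --> \oo] --> K * 0.
  by apply: cvgM; [exact: cvg_cst|exact: cvg_expr].
rewrite mulr0 => /cvgr0_norm_lt/(_ 1 ltr01)[N _ /(_ N.+1 (leqnSn _))] /=.
apply/negP; rewrite -leNgt; apply: le_trans (ler_norm _).
by rewrite expr_div_n mulrA ler_pdivlMr ?exprn_gt0// mul1r; exact: H.
Qed.

Theorem theorem3p2 (R : realType) (lambda : nat -> R) (phi : nat -> R -> R)
    (h_on : orthonormal_system (with_one phi))
    (h_l2 : cvgn (series (fun k => lambda k ^+ 2)))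
    (h_ge0 : kernel_ge0 lambda phi) :
  let C := series_copula lambda phi in
  is_copula C /\
  (forall n u v, (1 <= n)%N -> u \in `[0, 1] -> v \in `[0, 1] ->
     copula_pow C n u v = series_copula (fun k => lambda k ^+ n) phi u v) /\
  (forall (d : measure_display) (T : measurableType d) (P : probability T R)
     (U : nat -> {RV P >-> R}) (kappa : R.-pker R ~> R),
     stationary_chain U C kappa ->
     [/\ forall n, (1 <= n)%N ->
           rho U n = ereal_sup (range (fun k => (`|lambda k| ^+ n)%:E)),
         (geometrically_ergodic kappa (unif R) /\ exp_rho_mixing U) <->
           (ereal_sup (range (fun k => `|lambda k|%:E)) < 1)%E &
         finite_set [set k | lambda k != 0] ->
           (forall k, `|lambda k| < 1) -> psi_mixing U]).
Proof.
move=> C; have [c h_c c0] := h_ge0.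
split; first exact: (is_copula_series h_on h_c c0).
split=> [n u v n0 uI vI|d T P U kappa hU].
  by rewrite (copula_pow_ip h_on h_c)// (series_copulaE h_on h_c).
have rhoE := rho_chain h_on h_c c0 hU.
split; [exact: rhoE| |exact: (psi_mixing_chain h_on h_c c0 hU)].
have lamS j : (`|lambda j|%:E <= ereal_sup (range (fun k => `|lambda k|%:E)))%E.
  by apply: ereal_sup_ubound; exists j.
split=> [[_ [r [K [r0 r1 rhoK]]]]|].
  (* The mixing rate r bounds all |lambda_j| at once, which keeps their supremum strictly below
     1. *)
  apply: (@le_lt_trans _ _ r%:E); last by rewrite lte_fin.
  apply: ge_ereal_sup => _ [j _ <-]; rewrite lee_fin.
  apply: (@le_of_exp_bound _ _ _ K) => // n n0; rewrite -lee_fin.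
  by apply: le_trans (rhoK n n0); rewrite rhoE//; apply: ereal_sup_ubound; exists j.
have S0 : (0 <= ereal_sup (range (fun k => `|lambda k|%:E)))%E.
  by apply: le_trans (lamS 0%N); rewrite lee_fin.
case: ereal_sup lamS S0 => [s| |] lamS S0 // s1.
have {}lamS j : `|lambda j| <= s by have := lamS j; rewrite lee_fin.
have s01 : 0 <= s < 1 by move: S0 s1; rewrite lee_fin lte_fin => -> ->.
split; first exact: (geometrically_ergodic_chain h_on h_c c0 hU s01 lamS).
exists s, 1; have /andP[s0 s1'] := s01; split=> // n n0; rewrite rhoE//.
apply: ge_ereal_sup => _ [j _ <-]; rewrite lee_fin mul1r.
by apply: lerXn2r; rewrite ?nnegrE.
Qed.
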